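(* Let $R$ be a principal ideal domain and $A_*,B_*,C_*,D_*$ chain complexes of $R$-modules such that $A_**_RD_*$, $B_**_RD_*$ and $C_**_RD_*$ are acyclic, and suppose $A_*\xrightarrow{e_*}B_*\xrightarrow{f_*}C_*$ is weak exact. Then for $a\in H_i(C_* )$, $b\in H_j(D_* )$ and $r\in R$ with $ar=0$, $rb=0$, $$\boldsymbol\partial_{i+j+1}\bigl(\langle\!\langle a,r,b\rangle\!\rangle\bigr)\subset-\langle\!\langle\boldsymbol\partial_i(a),r,b\rangle\!\rangle ,$$ where $\boldsymbol\partial_i\colon H_i(C_* )\to H_{i-1}(A_* )$ is the boundary map of the weak exact sequence and $\boldsymbol\partial_{i+j+1}\colon H_{i+j+1}(C_*\otimes_RD_* )\to H_{i+j}(A_*\otimes_RD_* )$ is the boundary map of the weak exact sequence $A_*\otimes_RD_*\to B_*\otimes_RD_*\to C_*\otimes_RD_*$.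
   Context: Chain complexes are indexed by $\mathbb{Z}$, differential of degree $-1$; $\partial(x\otimes y)=\partial x\otimes y+(-1)^{|x|}x\otimes\partial y$; $[x]\times[y]=[x\otimes y]$. $\mathbf Z_n(C_* )$ denotes the cycles. $M*_RN=\mathrm{Tor}_1^R(M,N)$; $A_**_RB_*$ is the complex with degree-$n$ part $\bigoplus_{i+j=n}A_i*_RB_j$, defined like the tensor product complex. For a free resolution $0\to K\to F\to M\to0$, $M*_RN=\ker(K\otimes_RN\to F\otimes_RN)$; for $ar=0$, $rb=0$ the elementary tor $\langle a,r,b\rangle$ is $(\tilde ar)\otimes b$ with $\tilde a\in F$ a lift of $a$. Free approximation: a chain map $\eta\colon F_*\to A_*$ with $F_*$ a complex of free modules which is a quasi-isomorphism. Weak exact sequence: composable chain maps $A_*\xrightarrow{e_*}B_*\xrightarrow{f_*}C_*$ form a weak exact sequence if there are free approximations $\eta^A\colon F^A_*\to A_*$, $\eta^B\colon F^B_*\to B_*$, $\eta^C\colon F^C_*\to C_*$ and a short exact sequence of chain maps $0\to F^A_*\to F^B_*\to F^C_*\to0$ covering $e_*$ and $f_*$ (the resulting squares commute). Fixing such a diagram, its boundary map is $\boldsymbol\partial_i=\eta^A_*\circ\partial_i\circ(\eta^C_* )^{-1}\colon H_i(C_* )\to H_{i-1}(A_* )$, where $\partial_i$ is the connecting map of the short exact sequence of free complexes. Under the acyclicity assumptions, for a free approximation $\eta^D\colon F^D_*\to D_*$, the maps $\eta^A\otimes\eta^D$, $\eta^B\otimes\eta^D$, $\eta^C\otimes\eta^D$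 are free approximations exhibiting $A_*\otimes D_*\to B_*\otimes D_*\to C_*\otimes D_*$ as weak exact; this diagram is used for its boundary map. Weak splitting: a weak splitting $\mathfrak g^A_*$ of $A_*$ consists, for each $n$, of a free resolution $0\to\mathcal B^A_n\subset\mathcal Z^A_n\xrightarrow{\hat\gamma^A_n}H_n(A_* )\to0$ and $R$-module maps $\gamma^A_n\colon\mathcal Z^A_n\to\mathbf Z_n(A_* )$, $\theta^A_n\colon\mathcal B^A_n\to A_{n+1}$ with $[\gamma^A_n(z)]=\hat\gamma^A_n(z)$ on $\mathcal Z^A_n$ and $\partial^A\theta^A_n=\gamma^A_n$ on $\mathcal B^A_n$. These exist for every complex. Coset: for complexes $P_*,Q_*$ with $P_**_RQ_*$ acyclic, $p\in H_k(P_* )$, $q\in H_l(Q_* )$, $pr=0$, $rq=0$, $\langle\!\langle p,r,q\rangle\!\rangle\subset H_{k+l+1}(P_*\otimes_RQ_* )$ is the coset of the subgroup $(p\times H_{l+1}(Q_* ))\oplus(H_{k+1}(P_* )\times q)$ containing $[(-1)^{k+1}\gamma^P_k(\hat p)\otimes\theta^Q_l(r\hat q)+\theta^P_k(\hat pr)\otimes\gamma^Q_l(\hat q)]$, where $\hat p\in\mathcal Z^P_k$, $\hat q\in\mathcal Z^Q_l$ satisfy $\hat\gamma^P_k(\hat p)=p$, $\hat\gamma^Q_l(\hat q)=q$; it is independent of the lifts and of the weak splittings. *)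

(* Defs.v *)
From HB Require Import structures.
From mathcomp Require Import all_boot all_order all_algebra generic_quotient finmap.
From mathcomp Require Import mathcomp_extra boolp classical_sets functions.
From mathcomp Require Import cardinality fsbigop.

Set Implicit Arguments.
Unset Strict Implicit.
Unset Printing Implicit Defensive.

Import GRing.Theory.

Local Open Scope classical_set_scope.
Local Open Scope quotient_scope.
Local Open Scope ring_scope.

Definition principal_ideal_domain (R : idomainType) : Prop :=
  forall I : set R, I 0 -> (forall x y, I x -> I y -> I (x + y)) ->
    (forall a x, I x -> I (a * x)) ->
  exists d : R, I = [set x | exists a, x = a * d].

(** * Kernels, images, generated submodules, quotients *)

Section Kernel.
Variables (R : idomainType) (U V : lmodType R) (f : {linear U -> V}).

Definition ker_pred : pred U := fun x => f x == 0.

Lemma ker_pred_submod : submod_closed ker_pred.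
Proof.
split=> [|a x y]; rewrite !unfold_in ?linear0 // => /eqP fx /eqP fy.
by rewrite linearP fx fy scaler0 addr0.
Qed.

HB.instance Definition _ := GRing.isSubmodClosed.Build R U ker_pred
  ker_pred_submod.

Record kerM := KerM { kerM_val : U; kerM_valP : kerM_val \in ker_pred }.

HB.instance Definition _ := [isSub for kerM_val].
HB.instance Definition _ := [Choice of kerM by <:].
HB.instance Definition _ := [SubChoice_isSubLmodule of kerM by <:].

Lemma kerM_valE (x : kerM) : f (val x) = 0.
Proof. by apply/eqP; have := valP x. Qed.

Definition im_pred : pred V := fun y => `[< exists x, f x = y >].

Lemma im_pred_submod : submod_closed im_pred.
Proof.
split=> [|a x y]; rewrite !unfold_in; first by apply/asboolP; exists 0; rewrite linear0.
move=> /asboolP [u <-] /asboolP [v <-]; apply/asboolP.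
by exists (a *: u + v); rewrite linearP.
Qed.

HB.instance Definition _ := GRing.isSubmodClosed.Build R V im_pred
  im_pred_submod.

Definition imM : submodClosed V := GRing.SubmodClosed.clone R V im_pred _.

Lemma imMP y : reflect (exists x, f x = y) (y \in imM).
Proof. exact: asboolP. Qed.
End Kernel.

Section KernelMap.
Variables (R : idomainType) (U V U' V' : lmodType R).
Variables (f : {linear U -> V}) (f' : {linear U' -> V'}) (h : {linear U -> U'}).
Hypothesis hf : forall x, f x = 0 -> f' (h x) = 0.

Lemma ker_map_subproof (x : kerM f) : h (val x) \in ker_pred f'.
Proof. by apply/eqP/hf/kerM_valE. Qed.

Definition ker_map (x : kerM f) : kerM f' := KerM (ker_map_subproof x).

Lemma ker_map_linear : linear ker_map.
Proof. by move=> a x y; apply: val_inj; rewrite /= !linearP. Qed.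

HB.instance Definition _ := GRing.isLinear.Build R (kerM f) (kerM f') *:%R
  ker_map ker_map_linear.
End KernelMap.

Section Span.
Variables (R : idomainType) (V : lmodType R) (S : set V).

Definition span_pred : pred V := fun x =>
  `[< forall P : set V, P 0 -> (forall a u v, P u -> P v -> P (a *: u + v)) ->
        S `<=` P -> P x >].

Lemma span_pred_submod : submod_closed span_pred.
Proof.
split=> [|a x y]; rewrite !unfold_in; first by apply/asboolP => P.
move=> /asboolP hx /asboolP hy; apply/asboolP => P P0 PL SP.
by apply: (PL); [apply: hx | apply: hy].
Qed.

HB.instance Definition _ := GRing.isSubmodClosed.Build R V span_pred
  span_pred_submod.

Definition spanM : submodClosed V := GRing.SubmodClosed.clone R V span_pred _.

Lemma mem_span x : S x -> x \in spanM.
Proof. by move=> Sx; apply/asboolP => P _ _; apply. Qed.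
End Span.

Section Quotient.
Variables (R : idomainType) (V : lmodType R) (S : submodClosed V).

Lemma submod_oppr x : x \in S -> - x \in S.
Proof. by rewrite -scaleN1r; apply: rpredZ. Qed.

Definition quot_equiv (x y : V) := x - y \in S.

Lemma quot_equivP : equiv_class_of quot_equiv.
Proof.
split=> [x|x y|y x z]; rewrite /quot_equiv ?subrr ?rpred0 //.
  by apply/idP/idP => /submod_oppr; rewrite opprB.
by move=> h1 h2; rewrite -[x](addrNK y) -addrA rpredD.
Qed.

Canonical quot_equiv_canonical := EquivRelPack quot_equivP.
Canonical quot_encModRel := defaultEncModRel quot_equiv.

Definition quotM := {eq_quot quot_equiv}.
HB.instance Definition _ : EqQuotient V quot_equiv quotM := EqQuotient.on quotM.
HB.instance Definition _ := Choice.on quotM.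

Definition qcl (x : V) : quotM := \pi_quotM x.

Lemma qcl_eq x y : qcl x = qcl y <-> x - y \in S.
Proof. by split=> [/eqP|h]; [|apply/eqP]; rewrite piE. Qed.

Lemma qcl_repr (x : quotM) : qcl (repr x) = x. Proof. exact: reprK. Qed.

Definition quot_add (x y : quotM) := qcl (repr x + repr y).
Definition quot_opp (x : quotM) := qcl (- repr x).
Definition quot_scale a (x : quotM) := qcl (a *: repr x).

Lemma repr_qcl x : repr (qcl x) - x \in S.
Proof. by apply/qcl_eq; rewrite qcl_repr. Qed.

Lemma qclD x y : qcl (x + y) = quot_add (qcl x) (qcl y).
Proof.
apply/esym/qcl_eq; rewrite opprD addrACA.
by apply: rpredD; apply: repr_qcl.
Qed.

Lemma qclZ a x : qcl (a *: x) = quot_scale a (qcl x).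
Proof. by apply/esym/qcl_eq; rewrite -scalerBr; apply: rpredZ; apply: repr_qcl. Qed.

Lemma qclN x : qcl (- x) = quot_opp (qcl x).
Proof.
by apply/esym/qcl_eq; rewrite -opprD; apply: submod_oppr; apply: repr_qcl.
Qed.

Let addqA : associative quot_add.
Proof.
move=> x y z; rewrite -[x]qcl_repr -[y]qcl_repr -[z]qcl_repr.
by rewrite -!qclD addrA.
Qed.

Let addqC : commutative quot_add.
Proof. by move=> x y; rewrite /quot_add addrC. Qed.

Let add0q : left_id (qcl 0) quot_add.
Proof. by move=> x; rewrite -[x]qcl_repr -qclD add0r. Qed.

Let addNq : left_inverse (qcl 0) quot_opp quot_add.
Proof. by move=> x; rewrite -[x]qcl_repr -qclN -qclD addNr. Qed.

HB.instance Definition _ :=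
  GRing.isZmodule.Build quotM addqA addqC add0q addNq.

Let scaleqA a b x : quot_scale a (quot_scale b x) = quot_scale (a * b) x.
Proof. by rewrite -[x]qcl_repr -!qclZ scalerA. Qed.

Let scale1q : left_id 1 quot_scale.
Proof. by move=> x; rewrite -[x]qcl_repr -qclZ scale1r. Qed.

Let scaleqDr : right_distributive quot_scale +%R.
Proof.
move=> a x y; rewrite -[x]qcl_repr -[y]qcl_repr.
by rewrite [_ + _ in LHS](esym (qclD _ _)) -!qclZ scalerDr qclD.
Qed.

Let scaleqDl x : {morph quot_scale^~ x : a b / a + b}.
Proof. by move=> a b; rewrite -[x]qcl_repr -!qclZ scalerDl qclD. Qed.

HB.instance Definition _ := GRing.Zmodule_isLmodule.Build R quotM
  scaleqA scale1q scaleqDr scaleqDl.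

Lemma qcl_linear : linear qcl.
Proof. by move=> a x y; rewrite qclD qclZ. Qed.

HB.instance Definition _ := GRing.isLinear.Build R V quotM *:%R qcl qcl_linear.

Lemma qcl_eq0 x : qcl x = 0 <-> x \in S.
Proof. by rewrite -[x in x \in S]subr0 -qcl_eq linear0. Qed.

Section Lift.
Variables (W : lmodType R) (f : {linear V -> W}).
Hypothesis hf : forall x, x \in S -> f x = 0.

Definition quot_lift of (forall x, x \in S -> f x = 0) :=
  fun x : quotM => f (repr x).

Lemma quot_liftE x : quot_lift hf (qcl x) = f x.
Proof. by apply/eqP; rewrite -subr_eq0 -linearB hf // repr_qcl. Qed.

Lemma quot_lift_linear : linear (quot_lift hf).
Proof.
move=> a x y; rewrite -[x]qcl_repr -[y]qcl_repr -linearP !quot_liftE.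
exact: linearP.
Qed.

HB.instance Definition _ := GRing.isLinear.Build R quotM W *:%R
  (quot_lift hf) quot_lift_linear.
End Lift.
End Quotient.

(** * Direct sums and free modules *)

Section DirectSum.
Variables (R : idomainType) (I : choiceType) (T : I -> lmodType R).

Record dsum := DSum {
  dsum_fun :> forall i, T i;
  dsum_finite : finite_set [set i | dsum_fun i <> 0] }.

HB.instance Definition _ := gen_eqMixin dsum.
HB.instance Definition _ := gen_choiceMixin dsum.

Lemma dsumP (x y : dsum) : (forall i, x i = y i) -> x = y.
Proof.
case: x y => [x hx] [y hy] /= e.
have {}e : x = y by exact: functional_extensionality_dep.
by subst y; congr DSum; apply: Prop_irrelevance.
Qed.

Lemma dsum0_subproof : finite_set [set i | (0 : T i) <> 0].
Proof. by apply: (@sub_finite_set _ _ set0) => // i /= /(_ erefl). Qed.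
Definition dsum0 := DSum dsum0_subproof.

Lemma dsumD_subproof (x y : dsum) : finite_set [set i | x i + y i <> 0].
Proof.
have h : finite_set ([set i | x i <> 0] `|` [set i | y i <> 0]).
  by rewrite finite_setU; split; apply: dsum_finite.
apply: sub_finite_set h => i /= h; apply: contrapT => /not_orP [].
by move=> /contrapT xi /contrapT yi; apply: h; rewrite xi yi addr0.
Qed.
Definition dsumD x y := DSum (dsumD_subproof x y).

Lemma dsumZ_subproof a (x : dsum) : finite_set [set i | a *: x i <> 0].
Proof.
apply: sub_finite_set (dsum_finite x) => i /= h xi; apply: h.
by rewrite xi scaler0.
Qed.
Definition dsumZ a x := DSum (dsumZ_subproof a x).

Let addA : associative dsumD.
Proof. by move=> x y z; apply: dsumP => i /=; rewrite addrA. Qed.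
Let addC : commutative dsumD.
Proof. by move=> x y; apply: dsumP => i /=; rewrite addrC. Qed.
Let add0 : left_id dsum0 dsumD.
Proof. by move=> x; apply: dsumP => i /=; rewrite add0r. Qed.
Let addN : left_inverse dsum0 (dsumZ (-1)) dsumD.
Proof. by move=> x; apply: dsumP => i /=; rewrite scaleN1r addNr. Qed.

HB.instance Definition _ := GRing.isZmodule.Build dsum addA addC add0 addN.

Let scaleA a b x : dsumZ a (dsumZ b x) = dsumZ (a * b) x.
Proof. by apply: dsumP => i /=; rewrite scalerA. Qed.
Let scale1 : left_id 1 dsumZ.
Proof. by move=> x; apply: dsumP => i /=; rewrite scale1r. Qed.
Let scaleDr : right_distributive dsumZ +%R.
Proof. by move=> a x y; apply: dsumP => i /=; rewrite scalerDr. Qed.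
Let scaleDl x : {morph dsumZ^~ x : a b / a + b}.
Proof. by move=> a b; apply: dsumP => i /=; rewrite scalerDl. Qed.

HB.instance Definition _ := GRing.Zmodule_isLmodule.Build R dsum
  scaleA scale1 scaleDr scaleDl.

Lemma dsumDE (x y : dsum) i : (x + y) i = x i + y i. Proof. by []. Qed.
Lemma dsumZE a (x : dsum) i : (a *: x) i = a *: x i. Proof. by []. Qed.
Lemma dsum0E i : (0 : dsum) i = 0. Proof. by []. Qed.

Section Injection.
Variable i : I.

Lemma dsin_subproof (m : T i) :
  finite_set [set j | @eqtype.dfwith I (fun j => T j) (fun=> 0) i m j <> 0].
Proof.
apply: (@sub_finite_set _ _ [set i]); last exact: finite_set1.
move=> j /= h; apply/esym/eqP; apply: contrapT => /negP ij.
by apply: h; rewrite eqtype.dfwith_out.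
Qed.

Definition dsin (m : T i) : dsum := DSum (dsin_subproof m).

Lemma dsin_linear : linear dsin.
Proof.
move=> a m n; apply: dsumP => j; rewrite dsumDE dsumZE /=.
have [<-|ij] := eqVneq i j; first by rewrite !eqtype.dfwith_in.
by rewrite !eqtype.dfwith_out // scaler0 addr0.
Qed.

HB.instance Definition _ := GRing.isLinear.Build R (T i) dsum *:%R
  dsin dsin_linear.
End Injection.

Definition dsum_supp (x : dsum) : {fset I} := fset_set [set i | x i <> 0].

Lemma dsum_suppP (x : dsum) i : x i <> 0 -> i \in dsum_supp x.
Proof. by move=> h; rewrite in_fset_set ?inE //; apply: dsum_finite. Qed.

Section Lift.
Variables (V : lmodType R) (f : forall i, {linear T i -> V}).

Definition dsum_lift (x : dsum) : V := \sum_(i \in [set: I]) f i (x i).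

Lemma dsum_liftE (A : {fset I}) (x : dsum) : (forall i, x i <> 0 -> i \in A) ->
  dsum_lift x = \sum_(i <- A) f i (x i).
Proof.
move=> xA; apply: fsbigTE => i iA; suff -> : x i = 0 by rewrite linear0.
by apply: contrapT => /xA; rewrite (negPf iA).
Qed.

Lemma dsum_lift_linear : linear dsum_lift.
Proof.
move=> a x y; pose A := (dsum_supp x `|` dsum_supp y)%fset.
have xA i : x i <> 0 -> i \in A by move=> h; rewrite in_fsetU dsum_suppP.
have yA i : y i <> 0 -> i \in A by move=> h; rewrite in_fsetU orbC dsum_suppP.
rewrite !(@dsum_liftE A) => [|//|//|i h]; last first.
  apply: contrapT => iA; apply: h; rewrite dsumDE dsumZE.
  have -> : x i = 0 by apply: contrapT => /xA.
  by rewrite scaler0 add0r; apply: contrapT => /yA.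
rewrite scaler_sumr -big_split /=.
by apply: eq_bigr => i _; rewrite linearP.
Qed.

HB.instance Definition _ := GRing.isLinear.Build R dsum V *:%R
  dsum_lift dsum_lift_linear.

Lemma dsum_lift_dsin i m : dsum_lift (dsin m) = f i m.
Proof.
rewrite (@dsum_liftE [fset i]%fset) ?big_seq_fset1 /= ?eqtype.dfwith_in //.
move=> j /= h; rewrite in_fset1; apply: contrapT => /negP ij; apply: h.
by rewrite eqtype.dfwith_out // eq_sym.
Qed.
End Lift.

Lemma dsum_sum_dsin (x : dsum) : x = \sum_(i <- dsum_supp x) dsin (x i).
Proof.
apply: dsumP => j.
have -> (s : seq I) (F : I -> dsum) :
    (\sum_(i <- s) F i) j = \sum_(i <- s) F i j.
  by elim: s => [|i s IH]; rewrite ?big_nil // !big_cons dsumDE IH.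
have [jx|jx] := boolP (j \in dsum_supp x).
  rewrite (big_rem j) //= eqtype.dfwith_in big_seq big1 ?addr0 // => i.
  rewrite mem_rem_uniq ?fset_uniq // inE => /andP [ij _].
  by rewrite eqtype.dfwith_out.
rewrite big_seq big1 => [|i ix]; last first.
  by rewrite /= eqtype.dfwith_out //; apply: contraNneq jx => <-.
by apply: contrapT => /dsum_suppP; rewrite (negPf jx).
Qed.

Lemma dsum_ext (V : lmodType R) (g h : {linear dsum -> V}) :
  (forall i (m : T i), g (dsin m) = h (dsin m)) -> g =1 h.
Proof.
move=> gh x; rewrite (dsum_sum_dsin x) !raddf_sum.
by apply: eq_bigr => i _; apply: gh.
Qed.
End DirectSum.

Section FreeModule.
Variables (R : idomainType).

Section ScaleAt.
Variables (V : lmodType R) (v : V).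
Definition scale_at (r : R^o) : V := r *: v.
Lemma scale_at_linear : linear scale_at.
Proof. by move=> a r s; rewrite /scale_at scalerDl scalerA. Qed.
HB.instance Definition _ := GRing.isLinear.Build R R^o V *:%R
  scale_at scale_at_linear.
End ScaleAt.

Variable X : choiceType.

Definition regM (_ : X) : lmodType R := R^o.

Definition freeM : lmodType R := dsum regM.

Definition fgen (x : X) : freeM := @dsin R X regM x (1 : R^o).

Definition free_lift (V : lmodType R) (e : X -> V) : {linear freeM -> V} :=
  @dsum_lift R X regM V (fun x => scale_at (e x)).

Lemma free_lift_gen (V : lmodType R) (e : X -> V) x :
  free_lift e (fgen x) = e x.
Proof. by rewrite /free_lift /fgen /= dsum_lift_dsin /= /scale_at scale1r. Qed.

Lemma free_ext (V : lmodType R) (g h : {linear freeM -> V}) :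
  (forall x, g (fgen x) = h (fgen x)) -> g =1 h.
Proof.
move=> gh; apply: dsum_ext => x m.
have -> : @dsin R X regM x m = m *: fgen x.
  by rewrite /fgen -linearZ; congr dsin; apply/esym/mulr1.
by rewrite !linearZ gh.
Qed.
End FreeModule.

Definition is_free (R : idomainType) (M : lmodType R) : Prop :=
  exists B : set M,
    (forall (s : seq M) (c : M -> R), uniq s -> {in s, forall x, B x} ->
       \sum_(x <- s) c x *: x = 0 -> {in s, forall x, c x = 0}) /\
    (forall m : M, exists (s : seq M) (c : M -> R),
       {in s, forall x, B x} /\ m = \sum_(x <- s) c x *: x).

(** * Tensor products *)

Section Tensor.
Variables (R : idomainType) (M N : lmodType R).

Definition tens_rel : set (freeM R (M * N)%type) := [set u |
  (exists a m m' n,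
     u = fgen R (a *: m + m', n) - (a *: fgen R (m, n) + fgen R (m', n))) \/
  (exists a m n n',
     u = fgen R (m, a *: n + n') - (a *: fgen R (m, n) + fgen R (m, n')))].

Definition tensor : lmodType R :=
  quotM (spanM tens_rel).

Definition tens (m : M) (n : N) : tensor :=
qcl (spanM tens_rel) (fgen R (m, n)).

Lemma tens_linearl n : linear (tens^~ n).
Proof.
move=> a m m'; rewrite /tens -linearP; apply/qcl_eq/mem_span.
by left; exists a, m, m', n.
Qed.

Lemma tens_linearr m : linear (tens m).
Proof.
move=> a n n'; rewrite /tens -linearP; apply/qcl_eq/mem_span.
by right; exists a, m, n, n'.
Qed.

Lemma tens_ext (V : lmodType R) (g h : {linear tensor -> V}) :
  (forall m n, g (tens m n) = h (tens m n)) -> g =1 h.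
Proof.
move=> gh t; rewrite -[t]qcl_repr.
apply: (@free_ext R _ V (g \o qcl (spanM tens_rel))
  (h \o qcl (spanM tens_rel))) => -[m n].
exact: gh.
Qed.

Section Lift.
Variables (V : lmodType R) (b : M -> N -> V).
Hypotheses (bl : forall n, linear (b^~ n)) (br : forall m, linear (b m)).

Lemma tens_lift_subproof (u : freeM R (M * N)%type) :
  u \in spanM tens_rel -> free_lift (fun p => b p.1 p.2) u = 0.
Proof.
set F := free_lift _ => /asboolP/(_ [set u | F u = 0]); apply;
  rewrite /mkset.
- exact: linear0.
- by move=> a x y hx hy; rewrite linearP hx hy scaler0 addr0.
- move=> _ [[a [m [m' [n ->]]]]|[a [m [n [n' ->]]]]];
  by rewrite linearB linearP /F !free_lift_gen /= ?bl ?br subrr.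
Qed.

Definition tens_lift : {linear tensor -> V} :=
  quot_lift tens_lift_subproof.

Lemma tens_liftE m n : tens_lift (tens m n) = b m n.
Proof.
by apply: (etrans (quot_liftE tens_lift_subproof _)); rewrite free_lift_gen.
Qed.
End Lift.
End Tensor.

Section TensorMap.
Variables (R : idomainType) (M M' N N' : lmodType R).
Variables (f : {linear M -> M'}) (g : {linear N -> N'}).

Lemma tens_map_subproofl n : linear (fun m => tens (f m) (g n)).
Proof. by move=> a m m'; rewrite linearP tens_linearl. Qed.

Lemma tens_map_subproofr m : linear (fun n => tens (f m) (g n)).
Proof. by move=> a n n'; rewrite linearP tens_linearr. Qed.

Definition tens_map : {linear tensor M N -> tensor M' N'} :=
  tens_lift tens_map_subproofl tens_map_subproofr.

Lemma tens_mapE m n : tens_map (tens m n) = tens (f m) (g n).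
Proof. exact: tens_liftE. Qed.
End TensorMap.

(** * The bifunctors [tensor] and [tor] *)

Record bifunctor (R : idomainType) := Bifunctor {
  bi_obj :> lmodType R -> lmodType R -> lmodType R;
  bi_map : forall M M' N N' : lmodType R,
    {linear M -> M'} -> {linear N -> N'} ->
    {linear bi_obj M N -> bi_obj M' N'};
  bi_ext : forall (M M' N N' : lmodType R)
      (f f' : {linear M -> M'}) (g g' : {linear N -> N'}),
    f =1 f' -> g =1 g' -> bi_map f g =1 bi_map f' g';
  bi_id : forall (M N : lmodType R) (t : bi_obj M N),
    bi_map (idfun : {linear M -> M}) (idfun : {linear N -> N}) t = t;
  bi_comp : forall (M M' M'' N N' N'' : lmodType R)
      (f : {linear M -> M'}) (f' : {linear M' -> M''})
      (g : {linear N -> N'}) (g' : {linear N' -> N''}) (t : bi_obj M N),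
    bi_map f' g' (bi_map f g t) = bi_map (f' \o f) (g' \o g) t;
  bi_zerol : forall (M M' N N' : lmodType R)
      (f : {linear M -> M'}) (g : {linear N -> N'}) (t : bi_obj M N),
    (forall x, f x = 0) -> bi_map f g t = 0;
  bi_zeror : forall (M M' N N' : lmodType R)
      (f : {linear M -> M'}) (g : {linear N -> N'}) (t : bi_obj M N),
    (forall y, g y = 0) -> bi_map f g t = 0 }.

Section TensorBifunctor.
Variable R : idomainType.
Implicit Types M N : lmodType R.

Lemma tens0l M N (n : N) : tens (0 : M) n = 0.
Proof.
have /= := tens_linearl n (-1) (0 : M) 0.
by rewrite scaler0 addr0 scaleN1r addNr.
Qed.

Lemma tens0r M N (m : M) : tens m (0 : N) = 0.
Proof.
have /= := tens_linearr m (-1) (0 : N) 0.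
by rewrite scaler0 addr0 scaleN1r addNr.
Qed.

Lemma tens_map_ext M M' N N' (f f' : {linear M -> M'})
    (g g' : {linear N -> N'}) :
  f =1 f' -> g =1 g' -> tens_map f g =1 tens_map f' g'.
Proof. by move=> ff gg; apply: tens_ext => m n; rewrite !tens_mapE ff gg. Qed.

Lemma tens_map_id M N (t : tensor M N) :
  tens_map (idfun : {linear M -> M}) (idfun : {linear N -> N}) t = t.
Proof.
apply: (tens_ext (h := idfun : {linear tensor M N -> tensor M N})) => m n.
by rewrite tens_mapE.
Qed.

Lemma tens_map_comp M M' M'' N N' N'' (f : {linear M -> M'})
    (f' : {linear M' -> M''}) (g : {linear N -> N'}) (g' : {linear N' -> N''})
    (t : tensor M N) :
  tens_map f' g' (tens_map f g t) = tens_map (f' \o f) (g' \o g) t.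
Proof.
apply: (tens_ext (g := tens_map f' g' \o tens_map f g)) => m n.
by rewrite -[LHS]/(tens_map f' g' (tens_map f g (tens m n))) !tens_mapE.
Qed.

Lemma tens_map0l M M' N N' (f : {linear M -> M'}) (g : {linear N -> N'})
    (t : tensor M N) : (forall x, f x = 0) -> tens_map f g t = 0.
Proof.
move=> f0; apply: (tens_ext (h := \0 : {linear tensor M N -> _})) => m n.
by rewrite tens_mapE f0 tens0l.
Qed.

Lemma tens_map0r M M' N N' (f : {linear M -> M'}) (g : {linear N -> N'})
    (t : tensor M N) : (forall y, g y = 0) -> tens_map f g t = 0.
Proof.
move=> g0; apply: (tens_ext (h := \0 : {linear tensor M N -> _})) => m n.
by rewrite tens_mapE g0 tens0r.
Qed.

Definition tensor_bifunctor : bifunctor R :=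
  Bifunctor tens_map_ext tens_map_id tens_map_comp tens_map0l tens_map0r.
End TensorBifunctor.

(* Tor_1 computed from the functorial free resolution
   0 -> syz M -> freeM R M -> M -> 0; over a principal ideal domain the
   submodule syz M of a free module is free. *)
Section Tor.
Variable R : idomainType.
Implicit Types M N : lmodType R.

Definition free_cover M : {linear freeM R M -> M} := free_lift id.

Definition syz M : lmodType R := kerM (free_cover M).

Definition syz_inc M : {linear syz M -> freeM R M} :=
  (val : kerM (free_cover M) -> freeM R M).

Definition free_map M M' (f : {linear M -> M'}) :
    {linear freeM R M -> freeM R M'} :=
  free_lift (fun m => fgen R (f m)).

Lemma free_cover_map M M' (f : {linear M -> M'}) x :
  free_cover M' (free_map f x) = f (free_cover M x).
Proof.
apply: (free_ext (g := free_cover M' \o free_map f)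
  (h := f \o free_cover M)) => m.
rewrite -[LHS]/(free_cover M' (free_map f (fgen R m))).
rewrite -[RHS]/(f (free_cover M (fgen R m))).
by rewrite /free_cover /free_map !free_lift_gen.
Qed.

Lemma syz_map_subproof M M' (f : {linear M -> M'}) x :
  free_cover M x = 0 -> free_cover M' (free_map f x) = 0.
Proof. by move=> x0; rewrite free_cover_map x0 linear0. Qed.

Definition syz_map M M' (f : {linear M -> M'}) : {linear syz M -> syz M'} :=
  ker_map (@syz_map_subproof M M' f).

Definition tor M N : lmodType R :=
  kerM (tens_map (syz_inc M) (idfun : {linear N -> N})).

Section TorMap.
Variables (M M' N N' : lmodType R).
Variables (f : {linear M -> M'}) (g : {linear N -> N'}).

Lemma tor_map_subproof (x : tensor (syz M) N) :
  tens_map (syz_inc M) (idfun : {linear N -> N}) x = 0 ->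
  tens_map (syz_inc M') (idfun : {linear N' -> N'})
    (tens_map (syz_map f) g x) = 0.
Proof.
move=> x0; rewrite tens_map_comp.
rewrite (@tens_map_ext _ _ _ _ _ _ (free_map f \o syz_inc M) _ (g \o idfun)) //.
by rewrite -tens_map_comp x0 linear0.
Qed.

Definition tor_map : {linear tor M N -> tor M' N'} :=
  ker_map tor_map_subproof.

Lemma val_tor_map x : val (tor_map x) = tens_map (syz_map f) g (val x).
Proof. by []. Qed.
End TorMap.

Lemma free_map_ext M M' (f f' : {linear M -> M'}) :
  f =1 f' -> free_map f =1 free_map f'.
Proof.
by move=> ff; apply: free_ext => m; rewrite /free_map !free_lift_gen ff.
Qed.

Lemma syz_map_ext M M' (f f' : {linear M -> M'}) :
  f =1 f' -> syz_map f =1 syz_map f'.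
Proof. by move=> ff x; apply: val_inj; apply: free_map_ext. Qed.

Lemma free_map_id M x : free_map (idfun : {linear M -> M}) x = x.
Proof.
apply: (free_ext (h := idfun : {linear freeM R M -> freeM R M})) => m.
by rewrite /free_map free_lift_gen.
Qed.

Lemma free_map_comp M M' M'' (f : {linear M -> M'}) (f' : {linear M' -> M''})
  x : free_map f' (free_map f x) = free_map (f' \o f) x.
Proof.
apply: (free_ext (g := free_map f' \o free_map f)) => m.
rewrite -[LHS]/(free_map f' (free_map f (fgen R m))).
by rewrite /free_map !free_lift_gen.
Qed.

Lemma tor_map_ext M M' N N' (f f' : {linear M -> M'})
    (g g' : {linear N -> N'}) :
  f =1 f' -> g =1 g' -> tor_map f g =1 tor_map f' g'.
Proof.
move=> ff gg x; apply: val_inj; rewrite !val_tor_map.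
by apply: tens_map_ext => //; apply: syz_map_ext.
Qed.

Lemma tor_map_id M N (t : tor M N) :
  tor_map (idfun : {linear M -> M}) (idfun : {linear N -> N}) t = t.
Proof.
apply: val_inj; rewrite val_tor_map -[RHS]tens_map_id.
by apply: tens_map_ext => // x; apply: val_inj; apply: free_map_id.
Qed.

Lemma tor_map_comp M M' M'' N N' N'' (f : {linear M -> M'})
    (f' : {linear M' -> M''}) (g : {linear N -> N'}) (g' : {linear N' -> N''})
    (t : tor M N) :
  tor_map f' g' (tor_map f g t) = tor_map (f' \o f) (g' \o g) t.
Proof.
apply: val_inj; rewrite !val_tor_map tens_map_comp.
by apply: tens_map_ext => // x; apply: val_inj; apply: free_map_comp.
Qed.

Lemma tor_map0l M M' N N' (f : {linear M -> M'}) (g : {linear N -> N'})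
    (t : tor M N) : (forall x, f x = 0) -> tor_map f g t = 0.
Proof.
move=> f0; apply: val_inj; rewrite val_tor_map [RHS]linear0.
have e_subproof m : fgen R (f m) \in ker_pred (free_cover M').
  by apply/eqP; rewrite /free_cover free_lift_gen.
pose s : {linear freeM R M -> syz M'} :=
  free_lift (fun m => KerM (e_subproof m) : syz M').
have es : syz_map f =1 s \o syz_inc M.
  move=> x; apply: val_inj.
  apply: (free_ext (g := free_map f) (h := syz_inc M' \o s)) => m.
  rewrite -[RHS]/(syz_inc M' (s (fgen R m))) /s /free_map.
  by rewrite !free_lift_gen.
rewrite (@tens_map_ext _ _ _ _ _ _ (s \o syz_inc M) _ (g \o idfun)) //.
by rewrite -tens_map_comp (kerM_valE t) linear0.
Qed.

Lemma tor_map0r M M' N N' (f : {linear M -> M'}) (g : {linear N -> N'})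
    (t : tor M N) : (forall y, g y = 0) -> tor_map f g t = 0.
Proof.
by move=> g0; apply: val_inj; rewrite val_tor_map tens_map0r // linear0.
Qed.

Definition tor_bifunctor : bifunctor R :=
  Bifunctor tor_map_ext tor_map_id tor_map_comp tor_map0l tor_map0r.
End Tor.

(** * Chain complexes and homology *)

(* Every pair of degrees carries a map [cdiff m n], which is the differential
   if m = n + 1 and zero otherwise; this avoids transporting along equalities
   between degrees. *)
Record complex (R : idomainType) := Complex {
  cobj :> int -> lmodType R;
  cdiff : forall m n : int, {linear cobj m -> cobj n};
  cdiff_shape : forall m n (x : cobj m), m != n + 1 -> cdiff m n x = 0;
  cdiff_diff : forall m n p (x : cobj m), cdiff n p (cdiff m n x) = 0 }.

Record chain_map (R : idomainType) (A B : complex R) := ChainMap {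
  cmap :> forall n, {linear A n -> B n};
  cmap_diff : forall m n (x : A m),
    cmap n (cdiff A m n x) = cdiff B m n (cmap m x) }.

Definition chain_id (R : idomainType) (A : complex R) : chain_map A A :=
  @ChainMap R A A (fun _ => idfun) (fun _ _ _ => erefl).

Section Homology.
Variables (R : idomainType) (A : complex R).

Definition cycles (n : int) : lmodType R := kerM (cdiff A n (n - 1)).

Lemma cycleE n (z : cycles n) k : cdiff A n k (val z) = 0.
Proof.
have [nk|] := eqVneq n (k + 1); last exact: cdiff_shape.
have -> : k = n - 1 by rewrite nk addrK.
exact: kerM_valE z.
Qed.

Definition Cycle n (x : A n) (x_cycle : cdiff A n (n - 1) x = 0) : cycles n :=
  @KerM R _ _ (cdiff A n (n - 1)) x (introT eqP x_cycle).

Definition to_cycle n (x : A (n + 1)) : cycles n :=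
  Cycle (cdiff_diff n (n - 1) x).

Lemma to_cycle_linear n : linear (@to_cycle n).
Proof. by move=> a x y; apply: val_inj; rewrite /= linearP. Qed.

HB.instance Definition _ n := GRing.isLinear.Build R (A (n + 1)) (cycles n) *:%R
  (@to_cycle n) (@to_cycle_linear n).

Definition homology (n : int) : lmodType R :=
  quotM (imM (@to_cycle n : {linear A (n + 1) -> cycles n})).

Definition hclass n : {linear cycles n -> homology n} :=
  qcl (imM (@to_cycle n : {linear A (n + 1) -> cycles n})).

Lemma hclass_eq n (z z' : cycles n) :
  hclass n z = hclass n z' <->
  exists x : A (n + 1), cdiff A (n + 1) n x = val z - val z'.
Proof.
split=> [/qcl_eq/imMP [x xz]|[x xz]].
  by exists x; rewrite -[LHS]/(val (to_cycle x)) [to_cycle x]xz linearB.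
by apply/qcl_eq/imMP; exists x; apply: val_inj; rewrite linearB.
Qed.

Lemma hclass_surj n (h : homology n) : exists z, hclass n z = h.
Proof. by exists (repr h); apply: qcl_repr. Qed.

Definition acyclic : Prop := forall n (h : homology n), h = 0.
End Homology.

Section HomologyMap.
Variables (R : idomainType) (A B : complex R) (f : chain_map A B) (n : int).

Lemma cycles_map_subproof x :
  cdiff A n (n - 1) x = 0 -> cdiff B n (n - 1) (f n x) = 0.
Proof. by move=> x0; rewrite -cmap_diff x0 linear0. Qed.

Definition cycles_map : {linear cycles A n -> cycles B n} :=
  ker_map cycles_map_subproof.

Lemma homology_map_subproof (z : cycles A n) :
  z \in imM (@to_cycle R A n : {linear A (n + 1) -> cycles A n}) ->
  (hclass B n \o cycles_map) z = 0.
Proof.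
move=> /imMP [x <-]; apply/qcl_eq0/imMP; exists (f (n + 1) x).
by apply: val_inj; rewrite /= cmap_diff.
Qed.

Definition homology_map : {linear homology A n -> homology B n} :=
  quot_lift homology_map_subproof.

Lemma homology_mapE (z : cycles A n) :
  homology_map (hclass A n z) = hclass B n (cycles_map z).
Proof. exact: (quot_liftE homology_map_subproof). Qed.
End HomologyMap.

Definition quasi_isomorphism (R : idomainType) (A B : complex R)
    (f : chain_map A B) : Prop :=
  forall n, bijective (homology_map f n).

(** * Total complexes of bifunctors *)

Section Total.
Variables (R : idomainType) (F : bifunctor R).

Section Degree.
Variables (A B : int -> lmodType R) (n : int).

Definition tot_idx := {p : int * int | p.1 + p.2 == n}.

Definition tot_term (p : tot_idx) : lmodType R := F (A (val p).1) (B (val p).2).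

Definition tot_obj : lmodType R := dsum tot_term.

Definition tot_comp (x : tot_obj) (i j : int) : F (A i) (B j) :=
  match @idP (i + j == n) with
  | ReflectT e => x (exist _ (i, j) e)
  | ReflectF _ => 0
  end.

Definition tot_inj (p : tot_idx) : {linear tot_term p -> tot_obj} :=
  @dsin R _ tot_term p.

Definition tot_in (i j : int) (e : i + j = n) : {linear F (A i) (B j) -> tot_obj}
  := tot_inj (exist _ (i, j) (introT eqP e)).

Lemma tot_comp_idx (x : tot_obj) (p : tot_idx) :
  tot_comp x (val p).1 (val p).2 = x p.
Proof.
case: p => -[i j] /= e; rewrite /tot_comp.
by case: {-}_ / idP => // e'; rewrite (bool_irrelevance e' e).
Qed.

Lemma tot_comp_out (x : tot_obj) i j : i + j != n -> tot_comp x i j = 0.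
Proof. by move=> /negP; rewrite /tot_comp; case: {-}_ / idP. Qed.

Lemma tot_comp0 i j : tot_comp 0 i j = 0.
Proof. by rewrite /tot_comp; case: {-}_ / idP. Qed.

Lemma tot_comp_linear a (x y : tot_obj) i j :
  tot_comp (a *: x + y) i j = a *: tot_comp x i j + tot_comp y i j.
Proof. by rewrite /tot_comp; case: {-}_ / idP => // _; rewrite scaler0 addr0. Qed.

Lemma tot_ext (x y : tot_obj) :
  (forall i j : int, i + j = n -> tot_comp x i j = tot_comp y i j) -> x = y.
Proof.
move=> xy; apply: dsumP => p; rewrite -!tot_comp_idx; apply: xy.
exact/eqP/(valP p).
Qed.

Lemma tot_comp_in i j (e : i + j = n) t : tot_comp (tot_in e t) i j = t.
Proof.
have := tot_comp_idx (tot_in e t) (exist _ (i, j) (introT eqP e)).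
by move=> /= ->; rewrite eqtype.dfwith_in.
Qed.

Lemma tot_comp_in_out i j (e : i + j = n) t i' j' :
  (i, j) != (i', j') -> tot_comp (tot_in e t) i' j' = 0.
Proof.
move=> ij; rewrite /tot_comp; case: {-}_ / idP => // e'.
by rewrite /tot_in /= eqtype.dfwith_out.
Qed.

Lemma tot_comp_in_ind (Q : forall i j, F (A i) (B j) -> Prop) i j
    (e : i + j = n) t i' j' :
  Q i j t -> Q i' j' 0 -> Q i' j' (tot_comp (tot_in e t) i' j').
Proof.
move=> Qt Q0; have [[<- <-]|ij] := eqVneq (i, j) (i', j').
  by rewrite tot_comp_in.
by rewrite tot_comp_in_out.
Qed.

Lemma tot_finite (S : set tot_idx) (s : seq (int * int)) :
  (forall p, S p -> val p \in s) -> finite_set S.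
Proof.
move=> Ss; apply: (@sub_finite_set _ _ [set` (pmap insub s : seq tot_idx)]).
  by move=> p /Ss; rewrite /= mem_pmap_sub.
exact: finite_seq.
Qed.

Lemma tot_comp_supp (x : tot_obj) i j : tot_comp x i j <> 0 ->
  (i, j) \in [seq val p | p <- dsum_supp x].
Proof.
rewrite /tot_comp; case: {-}_ / idP => // e xe.
by apply/mapP; exists (exist _ (i, j) e) => //; apply: dsum_suppP.
Qed.
End Degree.

Section Complex.
Variables (A B : complex R).

Definition idF (M : lmodType R) : {linear M -> M} := idfun.

(* The component in F (A i) (B j) of the differential of x; the summands come
   from the components of x in F (A (i + 1)) (B j) and F (A i) (B (j + 1)). *)
Definition tot_diff_comp m (x : tot_obj A B m) i j : F (A i) (B j) :=
  bi_map F (cdiff A (i + 1) i) (idF (B j)) (tot_comp x (i + 1) j) +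
  (-1) ^ i *: bi_map F (idF (A i)) (cdiff B (j + 1) j) (tot_comp x i (j + 1)).

Lemma tot_diff_finite m n (x : tot_obj A B m) :
  finite_set [set p : tot_idx n | tot_diff_comp x (val p).1 (val p).2 <> 0].
Proof.
pose s := [seq val p | p <- dsum_supp x].
apply: (@tot_finite _ _ ([seq (p.1 - 1, p.2) | p <- s] ++
                         [seq (p.1, p.2 - 1) | p <- s])).
move=> [[i j] e] /= h; rewrite mem_cat; apply/orP; apply: contrapT.
move=> /not_orP [h1 h2]; apply: h; rewrite /tot_diff_comp.
have -> : tot_comp x (i + 1) j = 0.
  apply: contrapT => /tot_comp_supp hs; apply: h1; apply/mapP.
  by exists (i + 1, j); rewrite //= addrK.
have -> : tot_comp x i (j + 1) = 0.
  apply: contrapT => /tot_comp_supp hs; apply: h2; apply/mapP.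
  by exists (i, j + 1); rewrite //= addrK.
by rewrite !linear0 addr0.
Qed.

Definition tot_diff m n (x : tot_obj A B m) : tot_obj A B n :=
  DSum (tot_diff_finite n x).

Lemma tot_comp_diff m n (x : tot_obj A B m) i j : i + j = n ->
  tot_comp (tot_diff n x) i j = tot_diff_comp x i j.
Proof.
move=> /eqP e.
exact: (tot_comp_idx (tot_diff n x) (exist _ (i, j) e)).
Qed.

Lemma tot_diff_linear m n : linear (@tot_diff m n).
Proof.
move=> a x y; apply: tot_ext => i j e.
rewrite tot_comp_linear !tot_comp_diff // /tot_diff_comp !tot_comp_linear.
by rewrite !linearP scalerDr addrACA.
Qed.

HB.instance Definition _ m n :=
  GRing.isLinear.Build R (tot_obj A B m) (tot_obj A B n) *:%R
    (@tot_diff m n) (@tot_diff_linear m n).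

Lemma tot_diff_shape m n (x : tot_obj A B m) : m != n + 1 -> tot_diff n x = 0.
Proof.
move=> mn; apply: tot_ext => i j e; rewrite tot_comp0 tot_comp_diff //.
rewrite /tot_diff_comp (@tot_comp_out _ _ _ x (i + 1)); last first.
  by rewrite addrAC e eq_sym.
rewrite (@tot_comp_out _ _ _ x i); last by rewrite addrA e eq_sym.
by rewrite !linear0 addr0.
Qed.

Lemma tot_diff_diff m n p (x : tot_obj A B m) :
  tot_diff p (tot_diff n x) = 0.
Proof.
have [->|np] := eqVneq n (p + 1); last exact: tot_diff_shape.
apply: tot_ext => i j e; rewrite tot_comp0 tot_comp_diff // /tot_diff_comp.
rewrite !tot_comp_diff ?addrA ?e //; last by rewrite addrAC e.
rewrite /tot_diff_comp !linearD !linearZ !bi_comp.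
rewrite [X in X + _ + _]bi_zerol => [|y]; last exact: cdiff_diff.
rewrite (bi_zeror (idF (A i) \o idF (A i))) => [|y]; last first.
  exact: cdiff_diff.
rewrite (@bi_ext _ F _ _ _ _ (cdiff A (i + 1) i \o idF (A (i + 1)))
  (idF (A i) \o cdiff A (i + 1) i) (idF (B j) \o cdiff B (j + 1) j)
  (cdiff B (j + 1) j \o idF (B (j + 1)))) //.
set t := bi_map _ _ _ _.
rewrite -[LHS]/(0 + (-1) ^ (i + 1) *: t +
  ((-1) ^ i *: t + (-1) ^ i *: ((-1) ^ i *: 0))).
rewrite !scaler0 add0r addr0 exprzDr ?unitrN1 // expr1z mulrN1.
by rewrite scaleNr addNr.
Qed.

Definition tot : complex R :=
  @Complex R (tot_obj A B) (fun m n => @tot_diff m n : {linear _ -> _})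
    tot_diff_shape tot_diff_diff.
End Complex.

Section Map.
Variables (A A' B B' : complex R) (f : chain_map A A') (g : chain_map B B').

Lemma tot_map_finite n (x : tot_obj A B n) :
  finite_set [set p : tot_idx n |
    bi_map F (f (val p).1) (g (val p).2) (x p) <> 0].
Proof.
apply: sub_finite_set (dsum_finite x) => p /= h xp; apply: h.
by rewrite xp linear0.
Qed.

Definition tot_map_fun n (x : tot_obj A B n) : tot_obj A' B' n :=
  @DSum R _ (@tot_term A' B' n)
    (fun p => bi_map F (f (val p).1) (g (val p).2) (x p)) (tot_map_finite x).

Lemma tot_comp_map n (x : tot_obj A B n) i j :
  tot_comp (tot_map_fun x) i j = bi_map F (f i) (g j) (tot_comp x i j).
Proof.
by rewrite /tot_comp; case: {-}_ / idP => // _; rewrite linear0.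
Qed.

Lemma tot_map_linear n : linear (@tot_map_fun n).
Proof. by move=> a x y; apply: dsumP => p /=; rewrite -linearP. Qed.

HB.instance Definition _ n :=
  GRing.isLinear.Build R (tot_obj A B n) (tot_obj A' B' n) *:%R
    (@tot_map_fun n) (@tot_map_linear n).

Lemma tot_map_comm m n (x : tot_obj A B m) :
  tot_map_fun (tot_diff n x) = tot_diff n (tot_map_fun x).
Proof.
apply: tot_ext => i j e.
rewrite tot_comp_map !tot_comp_diff // /tot_diff_comp !tot_comp_map.
rewrite linearD !linearZ !bi_comp.
congr (_ + _ *: _); apply: bi_ext => y //=; rewrite /idF /=.
all: by rewrite cmap_diff.
Qed.

Definition tot_map : chain_map (tot A B) (tot A' B') :=
  @ChainMap R (tot A B) (tot A' B')
    (fun n => @tot_map_fun n : {linear _ -> _}) tot_map_comm.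
End Map.

Section Boundary.
Variables (A B : complex R) (i j m n : int).

(* If t comes from x (x) y with x a cycle (resp. y a cycle), its differential
   has only one summand. *)
Lemma tot_diff_in_cyclel (e : i + (j + 1) = m) (e' : i + j = n)
    (t : F (A i) (B (j + 1))) :
  (forall k, bi_map F (cdiff A i k) (idF (B (j + 1))) t = 0) ->
  cdiff (tot A B) m n (tot_in A B e t) =
  tot_in A B e' ((-1) ^ i *: bi_map F (idF (A i)) (cdiff B (j + 1) j) t).
Proof.
move=> t0; apply: tot_ext => i' j' ij'; rewrite tot_comp_diff // /tot_diff_comp.
have -> : bi_map F (cdiff A (i' + 1) i') (idF (B j'))
    (tot_comp (tot_in A B e t) (i' + 1) j') = 0.
  apply: (@tot_comp_in_ind A B m
    (fun a b u => bi_map F (cdiff A a i') (idF (B b)) u = 0)) => //.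
  exact: linear0.
rewrite add0r; have [ii|ii] := eqVneq i' i.
  subst i'; have jj : j' = j by apply: (addrI i); rewrite ij'.
  by subst j'; rewrite !tot_comp_in.
rewrite !tot_comp_in_out ?linear0 //.
- by rewrite xpair_eqE negb_and eq_sym ii.
- by rewrite xpair_eqE negb_and eq_sym ii.
Qed.

Lemma tot_diff_in_cycler (e : i + 1 + j = m) (e' : i + j = n)
    (t : F (A (i + 1)) (B j)) :
  (forall k, bi_map F (idF (A (i + 1))) (cdiff B j k) t = 0) ->
  cdiff (tot A B) m n (tot_in A B e t) =
  tot_in A B e' (bi_map F (cdiff A (i + 1) i) (idF (B j)) t).
Proof.
move=> t0; apply: tot_ext => i' j' ij'; rewrite tot_comp_diff // /tot_diff_comp.
have -> : bi_map F (idF (A i')) (cdiff B (j' + 1) j')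
    (tot_comp (tot_in A B e t) i' (j' + 1)) = 0.
  apply: (@tot_comp_in_ind A B m
    (fun a b u => bi_map F (idF (A a)) (cdiff B b j') u = 0)) => //.
  exact: linear0.
rewrite scaler0 addr0; have [jj|jj] := eqVneq j' j.
  subst j'; have ii : i' = i by apply: (addIr j); rewrite ij'.
  by subst i'; rewrite !tot_comp_in.
rewrite !tot_comp_in_out ?linear0 //.
- by rewrite xpair_eqE negb_and orbC eq_sym jj.
- by rewrite xpair_eqE negb_and orbC eq_sym jj.
Qed.
End Boundary.

Lemma tot_diff_in_cycle (A B : complex R) i j m n (e : i + j = m)
    (t : F (A i) (B j)) :
  (forall k, bi_map F (cdiff A i k) (idF (B j)) t = 0) ->
  (forall k, bi_map F (idF (A i)) (cdiff B j k) t = 0) ->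
  cdiff (tot A B) m n (tot_in A B e t) = 0.
Proof.
move=> tl tr; apply: tot_ext => i' j' ij'.
rewrite tot_comp0 tot_comp_diff // /tot_diff_comp.
rewrite (_ : bi_map F (cdiff A (i' + 1) i') _ _ = 0); last first.
  apply: (@tot_comp_in_ind A B m
    (fun a b u => bi_map F (cdiff A a i') (idF (B b)) u = 0)) => //.
  exact: linear0.
rewrite (_ : bi_map F _ (cdiff B (j' + 1) j') _ = 0); last first.
  apply: (@tot_comp_in_ind A B m
    (fun a b u => bi_map F (idF (A a)) (cdiff B b j') u = 0)) => //.
  exact: linear0.
by rewrite scaler0 addr0.
Qed.
End Total.

Section TensorComplex.
Variable R : idomainType.
Implicit Types P Q : complex R.

Definition tensor_complex P Q : complex R := tot (tensor_bifunctor R) P Q.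

Definition tor_complex P Q : complex R := tot (tor_bifunctor R) P Q.

Definition tensor_chain_map P P' Q Q' (f : chain_map P P') (g : chain_map Q Q') :
    chain_map (tensor_complex P Q) (tensor_complex P' Q') :=
  tot_map (tensor_bifunctor R) f g.

Definition ctens P Q (i j n : int) (e : i + j = n) (x : P i) (y : Q j) :
    tensor_complex P Q n :=
  tot_in (tensor_bifunctor R) P Q e (tens x y).

Lemma ctens_linearl P Q i j n (e : i + j = n) (y : Q j) :
  linear (fun x : P i => ctens e x y).
Proof. by move=> a x x'; rewrite /ctens tens_linearl linearP. Qed.

Lemma ctens_linearr P Q i j n (e : i + j = n) (x : P i) :
  linear (fun y : Q j => ctens e x y).
Proof. by move=> a y y'; rewrite /ctens tens_linearr linearP. Qed.

Lemma ctens0l P Q i j n (e : i + j = n) (y : Q j) : ctens e (0 : P i) y = 0.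
Proof. by rewrite /ctens tens0l linear0. Qed.

Lemma ctens0r P Q i j n (e : i + j = n) (x : P i) : ctens e x (0 : Q j) = 0.
Proof. by rewrite /ctens tens0r linear0. Qed.

Lemma ctensZl P Q i j n (e : i + j = n) a (x : P i) (y : Q j) :
  ctens e (a *: x) y = a *: ctens e x y.
Proof. by have := ctens_linearl e y a x 0; rewrite ctens0l !addr0. Qed.

Lemma ctensZr P Q i j n (e : i + j = n) a (x : P i) (y : Q j) :
  ctens e x (a *: y) = a *: ctens e x y.
Proof. by have := ctens_linearr e x a y 0; rewrite ctens0r !addr0. Qed.

Lemma ctensBl P Q i j n (e : i + j = n) (x x' : P i) (y : Q j) :
  ctens e (x - x') y = ctens e x y - ctens e x' y.
Proof.
have := ctens_linearl e y (-1) x' x; rewrite !scaleN1r => h.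
by rewrite [x - x']addrC h addrC.
Qed.

Lemma ctensBr P Q i j n (e : i + j = n) (x : P i) (y y' : Q j) :
  ctens e x (y - y') = ctens e x y - ctens e x y'.
Proof.
have := ctens_linearr e x (-1) y' y; rewrite !scaleN1r => h.
by rewrite [y - y']addrC h addrC.
Qed.

Lemma cdiff_ctensl P Q i j m n (e : i + (j + 1) = m) (e' : i + j = n)
    (x : cycles P i) (v : Q (j + 1)) :
  cdiff (tensor_complex P Q) m n (ctens e (val x) v) =
  (-1) ^ i *: ctens e' (val x) (cdiff Q (j + 1) j v).
Proof.
apply: (etrans (tot_diff_in_cyclel e e' _)) => [k|].
  by apply: (etrans (tens_mapE _ _ _ _)); rewrite cycleE tens0l.
rewrite linearZ; congr (_ *: tot_in _ _ _ _ _); exact: tens_mapE.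
Qed.

Lemma cdiff_ctensr P Q i j m n (e : i + 1 + j = m) (e' : i + j = n)
    (u : P (i + 1)) (y : cycles Q j) :
  cdiff (tensor_complex P Q) m n (ctens e u (val y)) =
  ctens e' (cdiff P (i + 1) i u) (val y).
Proof.
apply: (etrans (tot_diff_in_cycler e e' _)) => [k|].
  by apply: (etrans (tens_mapE _ _ _ _)); rewrite cycleE tens0r.
congr (tot_in _ _ _ _ _); exact: tens_mapE.
Qed.

Section Cross.
Variables (P Q : complex R) (i j n : int) (e : i + j = n).

Lemma cross_cycle_subproof (x : cycles P i) (y : cycles Q j) :
  cdiff (tensor_complex P Q) n (n - 1) (ctens e (val x) (val y)) = 0.
Proof.
apply: tot_diff_in_cycle => k; apply: (etrans (tens_mapE _ _ _ _));
by rewrite cycleE ?tens0l ?tens0r.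
Qed.

Definition cross_cycle (x : cycles P i) (y : cycles Q j) :
  cycles (tensor_complex P Q) n := Cycle (cross_cycle_subproof x y).

Definition cross (p : homology P i) (q : homology Q j) :
    homology (tensor_complex P Q) n :=
  hclass _ _ (cross_cycle (repr p) (repr q)).

Lemma crossE (x : cycles P i) (y : cycles Q j) :
  cross (hclass P i x) (hclass Q j y) =
  hclass (tensor_complex P Q) n (cross_cycle x y).
Proof.
rewrite /cross; set x' := repr _; set y' := repr _.
have /hclass_eq [u ux] : hclass P i x' = hclass P i x by apply: qcl_repr.
have /hclass_eq [v vy] : hclass Q j y' = hclass Q j y by apply: qcl_repr.
have eu : i + 1 + j = n + 1 by rewrite addrAC e.
have ev : i + (j + 1) = n + 1 by rewrite addrA e.
apply/hclass_eq; exists (ctens eu u (val y') + (-1) ^ (- i) *: ctens ev (val x) v).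
rewrite linearD linearZ_LR (cdiff_ctensr _ e) (cdiff_ctensl _ e) ux vy scalerA.
rewrite -exprzDr ?unitrN1 // addNr expr0z scale1r.
by rewrite ctensBl ctensBr addrA subrK.
Qed.
End Cross.
End TensorComplex.

(** * Free approximations and weak exact sequences *)

Section WeakExact.
Variable R : idomainType.

Definition free_approximation (F A : complex R) (eta : chain_map F A) : Prop :=
  (forall n, is_free (F n)) /\ quasi_isomorphism eta.

Definition short_exact (F G H : complex R) (s : chain_map F G)
    (t : chain_map G H) : Prop :=
  forall n,
    [/\ injective (s n),
        forall y, t n y = 0 <-> exists x, s n x = y
      & forall z, exists y, t n y = z].

(* The underlying data of the diagram exhibiting A -> B -> C as weak exact. *)
Record approx_diagram (A B C : complex R) := ApproxDiagram {
  appA : complex R;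
  appB : complex R;
  appC : complex R;
  etaA : chain_map appA A;
  etaB : chain_map appB B;
  etaC : chain_map appC C;
  app_e : chain_map appA appB;
  app_f : chain_map appB appC }.

Definition weak_exact_diagram (A B C : complex R) (e : chain_map A B)
    (f : chain_map B C) (W : approx_diagram A B C) : Prop :=
  [/\ [/\ free_approximation (etaA W), free_approximation (etaB W)
        & free_approximation (etaC W)],
      short_exact (app_e W) (app_f W),
      forall n x, etaB W n (app_e W n x) = e n (etaA W n x)
    & forall n y, etaC W n (app_f W n y) = f n (etaB W n y)].

Definition weak_exact (A B C : complex R) (e : chain_map A B)
    (f : chain_map B C) : Prop :=
  exists W : approx_diagram A B C, weak_exact_diagram e f W.

(* The connecting map H_m -> H_n of a short exact sequence, for m = n + 1. *)
Definition connecting (F G H : complex R) (s : chain_map F G)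
    (t : chain_map G H) (m n : int) (h : homology H m) : homology F n :=
  xget 0 [set k | exists (z : cycles H m) (y : G m) (x : cycles F n),
    [/\ hclass H m z = h, t m y = val z, s n (val x) = cdiff G m n y
      & hclass F n x = k]].

Definition inverse (S T : lmodType R) (f : S -> T) (y : T) : S :=
  xget 0 [set x | f x = y].

Definition boundary_map (A B C : complex R) (W : approx_diagram A B C)
    (m n : int) (h : homology C m) : homology A n :=
  homology_map (etaA W) n
    (connecting (app_e W) (app_f W) n (inverse (homology_map (etaC W) m) h)).

Definition tensor_diagram (A B C D FD : complex R) (W : approx_diagram A B C)
    (etaD : chain_map FD D) :
    approx_diagram (tensor_complex A D) (tensor_complex B D)
      (tensor_complex C D) :=
  ApproxDiagram (tensor_chain_map (etaA W) etaD)
    (tensor_chain_map (etaB W) etaD) (tensor_chain_map (etaC W) etaD)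
    (tensor_chain_map (app_e W) (chain_id FD))
    (tensor_chain_map (app_f W) (chain_id FD)).
End WeakExact.

(** * Weak splittings and the cosets *)

Record weak_splitting (R : idomainType) (A : complex R) := WeakSplitting {
  ws_Z : int -> lmodType R;
  ws_pi : forall n, {linear ws_Z n -> homology A n};
  ws_gamma : forall n, {linear ws_Z n -> cycles A n};
  ws_theta : forall n, {linear kerM (ws_pi n) -> A (n + 1)};
  ws_Z_free : forall n, is_free (ws_Z n);
  ws_B_free : forall n, is_free (kerM (ws_pi n));
  ws_pi_surj : forall n (h : homology A n), exists z, ws_pi n z = h;
  ws_gamma_class : forall n (z : ws_Z n), hclass A n (ws_gamma n z) = ws_pi n z;
  ws_theta_diff : forall n (b : kerM (ws_pi n)),
    cdiff A (n + 1) n (ws_theta n b) = val (ws_gamma n (val b)) }.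

Section Coset.
Variables (R : idomainType) (P Q : complex R).
Variables (gP : weak_splitting P) (gQ : weak_splitting Q).
Variables (k l n : int) (e : k + l + 1 = n).

Lemma degl_subproof : k + (l + 1) = n. Proof. by rewrite addrA. Qed.
Lemma degr_subproof : k + 1 + l = n. Proof. by rewrite addrAC. Qed.

(* In the use below bp = p' * r and bq = r * q'. *)
Definition tor_chain (p' : ws_Z gP k) (q' : ws_Z gQ l)
    (bp : kerM (ws_pi gP k)) (bq : kerM (ws_pi gQ l)) : tensor_complex P Q n :=
  (-1) ^ (k + 1) *:
    ctens degl_subproof (val (ws_gamma gP k p')) (ws_theta gQ l bq) +
  ctens degr_subproof (ws_theta gP k bp) (val (ws_gamma gQ l q')).

Lemma tor_chain_diff r p' q' bp bq m :
  val bp = r *: p' -> val bq = r *: q' ->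
  cdiff (tensor_complex P Q) n m (tor_chain p' q' bp bq) = 0.
Proof.
move=> hp hq; have [nm|] := eqVneq n (m + 1); last exact: cdiff_shape.
have e' : k + l = m by apply: (addIr 1); rewrite e.
rewrite linearD linearZ_LR (cdiff_ctensl _ e') (cdiff_ctensr _ e').
have -> : cdiff P (k + 1) k (ws_theta gP k bp) = r *: val (ws_gamma gP k p').
  by rewrite ws_theta_diff hp (linearZ_LR (ws_gamma gP k)).
have -> : cdiff Q (l + 1) l (ws_theta gQ l bq) = r *: val (ws_gamma gQ l q').
  by rewrite ws_theta_diff hq (linearZ_LR (ws_gamma gQ l)).
rewrite ctensZl ctensZr scalerA exprzDr ?unitrN1 // expr1z mulrN1 mulNr.
rewrite -exprzMl ?unitrN1 // mulrNN mulr1 exp1rz.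
by rewrite scaleN1r addNr.
Qed.

(* The coset <<p, r, q>>, formed with the weak splittings gP and gQ; it is
   empty unless p r = 0 and r q = 0. *)
Definition tor_coset (p : homology P k) (r : R) (q : homology Q l) :
    set (homology (tensor_complex P Q) n) :=
  [set h | exists (p' : ws_Z gP k) (q' : ws_Z gQ l)
      (bp : kerM (ws_pi gP k)) (bq : kerM (ws_pi gQ l))
      (z : cycles (tensor_complex P Q) n)
      (u : homology Q (l + 1)) (w : homology P (k + 1)),
    [/\ ws_pi gP k p' = p /\ ws_pi gQ l q' = q,
        val bp = r *: p' /\ val bq = r *: q',
        val z = tor_chain p' q' bp bq
      & h = hclass _ n z + (cross degl_subproof p u + cross degr_subproof w q)]].
End Coset.

Lemma boundary_degree (i j : int) : i - 1 + j + 1 = i + j.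
Proof. by rewrite addrAC subrK. Qed.

(* Main.v *)
Require Import Defs.
From HB Require Import structures.
From mathcomp Require Import all_boot all_order all_algebra.
From mathcomp Require Import finmap ssrAC.
From mathcomp Require Import boolp classical_sets cardinality.

Set Implicit Arguments.
Unset Strict Implicit.
Unset Printing Implicit Defensive.

Import GRing.Theory.

Local Open Scope classical_set_scope.
Local Open Scope ring_scope.

(* Choose chains in the free approximations: cycles x, y representing a, b and
   u, v with du = r x, dv = r y. The class of (-1)^(i+1) x (x) v + u (x) y lies
   in the coset, and every other admissible choice (also in the complexes
   themselves) changes it only by classes [x] * [c] + [w] * [y]. Lifting x and u
   to the middle complex, the boundary of the lifted chain is minus the same
   expression formed with the boundary of x.

   The boundary map inverts H(F^C (x) F^D) -> H(C (x) D), so this map has to be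
   injective. Add to F^C a contractible free complex so that the resulting map
   P -> C becomes onto; its kernel K is free and acyclic, hence contractible,
   and so is K (x) D. The kernel of K (x) D -> P (x) D is the Tor complex, which
   is acyclic by hypothesis; a diagram chase concludes. The same argument in the
   second variable, where the Tor terms vanish, replaces F^D by D. *)

(** * Projective modules over a principal ideal domain *)

Section Projective.
Variable R : idomainType.
Implicit Types M N U V : lmodType R.

(** Injectivity on homology of the map from F^C (x) F^D to C (x) D is enough to invert it where
    needed: every element of the coset is exhibited as the image of an explicit class, and
    injectivity then forces the preimage chosen by [inverse].

    A free approximation is onto in homology but not on chains, while right exactness of the tensor
    product starts from a surjection. This is why the contractible summand is added; the projection
    of P back onto F^C returns a bounding chain found in P (x) D.

    The main obstacle is to recognise the kernel of K (x) D -> P (x) D as the Tor complex, which is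
    built from functorial free covers. Comparison maps between the two resolutions exist in each
    degree but are not chain maps. Their failure to commute factors through a projective middle
    term, so it vanishes on the kernels.

    Projectivity is used in place of freeness: it passes to retracts, to products and, over a
    principal ideal domain, to submodules, without following bases. *)

Definition linear_of M N (s : M -> N) (slin : linear s) : {linear M -> N} :=
  HB.pack s (GRing.isLinear.Build R M N *:%R s slin).

(** Differences of related pairs are related, so a relation closed under linear combinations is
    single-valued as soon as it is so at 0; any choice function for it is then linear. *)
Lemma linear_choice M U (S : M -> U -> Prop) :
  (forall m, exists u, S m u) ->
  (forall a m u m' u', S m u -> S m' u' -> S (a *: m + m') (a *: u + u')) ->
  (forall u, S 0 u -> u = 0) ->
  exists s : {linear M -> U}, forall m, S m (s m).
Proof.
move=> tot lin fct; have [s sS] := choice tot.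
have uniq m u u' : S m u -> S m u' -> u = u'.
  move=> h h'; have := lin (-1) _ _ _ _ h h'.
  by rewrite !scaleN1r addNr => /fct/eqP; rewrite addrC subr_eq0 => /eqP.
have slin : linear s by move=> a x y; apply: (uniq (a *: x + y)); auto.
by exists (linear_of slin).
Qed.

(** The map [f] is only asked to land in the image of [g]. Lifting along an exact sequence then does
    not require [g] to be replaced by a map onto its image. *)
Definition projective M : Prop :=
  forall U V (g : {linear U -> V}) (f : {linear M -> V}),
    (forall m, exists u, g u = f m) ->
    exists s : {linear M -> U}, forall m, g (s m) = f m.

Lemma projective_freeM (X : choiceType) : projective (freeM R X).
Proof.
move=> U V g f fg; have [u uE] := choice (fun x => fg (fgen R x)).
exists (free_lift u) => m.
by apply: (free_ext (g := g \o free_lift u)) => x /=; rewrite free_lift_gen.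
Qed.

Lemma projective_retract M N (s : {linear M -> N}) (t : {linear N -> M}) :
  (forall m, t (s m) = m) -> projective N -> projective M.
Proof.
move=> ts Nproj U V g f fg.
have [|k kE] := Nproj U V g (f \o t); first by move=> n; apply: fg.
by exists (k \o s) => m /=; rewrite kE /= ts.
Qed.

Lemma projective_pair M N :
  projective M -> projective N -> projective (M * N)%type.
Proof.
move=> Mproj Nproj U V g f fg.
have inl_lin : linear (fun m : M => (m, 0 : N)).
  by move=> a x y; rewrite -[RHS]/(_, _) /= scaler0 addr0.
have inr_lin : linear (fun n : N => (0 : M, n)).
  by move=> a x y; rewrite -[RHS]/(_, _) /= scaler0 addr0.
pose i1 : {linear M -> (M * N)%type} := linear_of inl_lin.
pose i2 : {linear N -> (M * N)%type} := linear_of inr_lin.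
have [|s1 s1E] := Mproj U V g (f \o i1); first by move=> m; apply: fg.
have [|s2 s2E] := Nproj U V g (f \o i2); first by move=> m; apply: fg.
exists ((s1 \o fst) \+ (s2 \o snd)) => -[m n] /=.
rewrite linearD s1E s2E /= -linearD; congr (f _).
by rewrite -[LHS]/(_, _) /= addr0 add0r.
Qed.

Lemma free_cover_surj M (m : M) : exists u, free_cover M u = m.
Proof. by exists (fgen R m); rewrite /free_cover free_lift_gen. Qed.

Lemma projective_cover_split M : projective M ->
  exists s : {linear M -> freeM R M}, forall m, free_cover M (s m) = m.
Proof.
move=> Mproj; apply: (Mproj _ _ (free_cover M) idfun) => m.
exact: free_cover_surj.
Qed.

(* Partial lifts are encoded as sets of the sum type [X + N * U]: the left part
   is the set of coordinates already treated, the right part the graph. *)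
Lemma projective_submodule_freeM (X : choiceType) N
    (i : {linear N -> freeM R X}) :
  principal_ideal_domain R -> injective i -> projective N.
Proof.
move=> pid iinj U V g f fg.
have i0 n : (forall x, i n x = 0) -> n = 0.
  by move=> h; apply: iinj; rewrite linear0; apply: dsumP => x; rewrite h.
pose T := (X + N * U)%type.
pose P (A : set T) := [/\
  forall a n u n' u', A (inr (n, u)) -> A (inr (n', u')) ->
    A (inr (a *: n + n', a *: u + u')),
  forall n u, A (inr (n, u)) ->
    g u = f n /\ (forall x, i n x <> 0 -> A (inl x)),
  forall u, A (inr (0, u)) -> u = 0
  (* The restriction to [n <> 0] lets the empty set, which is the union of the empty chain, satisfy
     [P]. The relation [S] below restores the pair (0, 0). *)
  & forall n, n <> 0 -> (forall x, i n x <> 0 -> A (inl x)) ->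
    exists u, A (inr (n, u))].
have [|A [[A1 A2 A3 A4] Amax]] := @Zorn_bigcup T P.
  move=> F FP Ftot; split.
  - move=> a n u n' u' [Y FY Yn] [Y' FY' Yn'].
    have [YY|YY] := Ftot _ _ FY FY'.
      exists Y' => //; have [h _ _ _] := FP _ FY'; apply: h => //; exact: YY.
    exists Y => //; have [h _ _ _] := FP _ FY; apply: h => //; exact: YY.
  - move=> n u [Y FY Yn]; have [_ h _ _] := FP _ FY.
    have [guf hx] := h _ _ Yn; split=> // x /hx Yx; by exists Y.
  - by move=> u [Y FY Yn]; have [_ _ h _] := FP _ FY; apply: h Yn.
  - move=> n n0 nF.
    suff [Y FY nY] : exists2 Y, F Y & forall x, i n x <> 0 -> Y (inl x).
      have [_ _ _ h] := FP _ FY; have [u Yu] := h _ n0 nY.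
      by exists u; exists Y.
    have [x0 x0n] : exists x, i n x <> 0.
      by apply: contrapT => h; apply/n0/i0 => x; apply: contrapT => xn;
        apply: h; exists x.
    have [Y0 FY0 _] := nF _ x0n.
    (* The support of [n] is finite, so a single member of the chain already contains it. *)
    have fin (s : seq X) : (forall x, x \in s -> i n x <> 0) ->
        exists2 Y, F Y & forall x, x \in s -> Y (inl x).
      elim: s => [|x s IH] hs; first by exists Y0.
      have [|Y FY sY] := IH.
        by move=> y ys; apply: hs; rewrite inE ys orbT.
      have [|Y' FY' xY'] := nF x; first by apply: hs; rewrite inE eqxx.
      have [YY|YY] := Ftot _ _ FY FY'.
        by exists Y' => // y; rewrite inE => /orP [/eqP ->|/sY/YY].
      by exists Y => // y; rewrite inE => /orP [/eqP ->|/sY //]; apply: YY.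
    have [|Y FY sY] := fin (filter (fun x => i n x != 0) (dsum_supp (i n))).
      by move=> x; rewrite mem_filter => /andP [/eqP].
    exists Y => // x xn; apply: sY; rewrite mem_filter; apply/andP; split.
      exact/eqP.
    exact: dsum_suppP.
pose S (n : N) (u : U) := A (inr (n, u)) \/ n = 0 /\ u = 0.
have Slin a n u n' u' : S n u -> S n' u' -> S (a *: n + n') (a *: u + u').
  move=> [h|[-> ->]] [h'|[-> ->]].
  - by left; apply: A1.
  - left; have h0 := A1 (-1) _ _ _ _ h h; have := A1 a _ _ _ _ h h0.
    by rewrite !scaleN1r !addNr.
  - by left; rewrite !scaler0 !add0r.
  - by right; rewrite !scaler0 !add0r.
have Sg n u : S n u -> g u = f n.
  by move=> [/A2 []//|[-> ->]]; rewrite !linear0.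
have Ssupp n u x : S n u -> i n x <> 0 -> A (inl x).
  by move=> [/A2 [_]|[-> _]]; [apply|rewrite linear0].
have Sfun u : S 0 u -> u = 0 by move=> [/A3|[]].
have Stot n : (forall x, i n x <> 0 -> A (inl x)) -> exists u, S n u.
  move=> nA; have [->|/eqP n0] := eqVneq n 0; first by exists 0; right.
  by have [u Au] := A4 _ n0 nA; exists u; left.
suff Afull x : A (inl x).
  have [//|s sS] := linear_choice (fun n => Stot n (fun x _ => Afull x)) Slin.
  by exists s => n; apply: Sg.
apply: contrapT => nAx.
pose near (n : N) := forall y, i n y <> 0 -> A (inl y) \/ y = x.
have nearL a n n' : near n -> near n' -> near (a *: n + n').
  move=> hn hn' y; rewrite linearP dsumDE dsumZE => h.
  apply: contrapT => hy; apply: h.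
  have -> : i n y = 0 by apply: contrapT => /hn.
  have -> : i n' y = 0 by apply: contrapT => /hn'.
  by rewrite scaler0 addr0.
have near0 : near 0 by move=> y; rewrite linear0.
(* The coordinates at [x] of the elements supported on treated coordinates and [x] form an ideal.
   Subtracting a multiple of an element whose coordinate is the generator [d] brings any of them
   back into the domain of [S]. *)
have [d [dn dE]] : exists d, (exists n, near n /\ i n x = d) /\
    forall n, near n -> exists a, i n x = a * d.
  case: (pid [set c | exists n, near n /\ i n x = c]).
  - by exists 0; split=> //; rewrite linear0.
  - move=> _ _ [n [hn <-]] [n' [hn' <-]]; exists (1 *: n + n').
    by split; [apply: nearL|rewrite linearP dsumDE dsumZE scale1r].
  - move=> a _ [n [hn <-]]; exists (a *: n + 0).
    by split; [apply: nearL|rewrite addr0 linearZ dsumZE].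
  - move=> d dE; exists d; split.
      have : [set x | exists a, x = a * d] d by exists 1; rewrite mul1r.
      by rewrite -dE.
    by move=> n hn; have : [set c | exists n, near n /\ i n x = c] (i n x)
      by [exists n]; rewrite dE.

(* For [d = 0] the pair is taken to be (0, 0): from a * d = 0 one could not conclude a = 0, and the
   term [a *: u0] would spoil single-valuedness of the extension at 0. *)
have [n0 [u0 [n0near n0x gu0 d0]]] : exists n0 u0, [/\ near n0, i n0 x = d,
    g u0 = f n0 & d = 0 -> n0 = 0 /\ u0 = 0].
  have [->|/eqP d0] := eqVneq d 0.
    by exists 0, 0; split=> //; rewrite !linear0.
  have [n0 [hn0 n0d]] := dn; have [u0 u0E] := fg n0.
  by exists n0, u0; split.
pose B (t : T) := match t with
  | inl y => A (inl y) \/ y = x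
  | inr (n, u) => exists a n' u', [/\ S n' u', n = n' + a *: n0 & u = u' + a *: u0]
  end.
have Sx n u : S n u -> i n x = 0.
  by move=> h; apply: contrapT => /(Ssupp _ _ _ h).
apply: (Amax B).
  split; last by move=> /(_ (inl x) (or_intror erefl)).
  move=> [y|[n u]] h; first by left.
  by exists 0, n, u; rewrite !scale0r !addr0; split=> //; left.
split.
- move=> c n u n' u' [a [m [v [Sm -> ->]]]] [a' [m' [v' [Sm' -> ->]]]].
  exists (c * a + a'), (c *: m + m'), (c *: v + v'); split; first exact: Slin.
    by rewrite scalerDr scalerDl addrACA scalerA.
  by rewrite scalerDr scalerDl addrACA scalerA.
- move=> n u [a [m [v [Sm -> ->]]]]; split.
    by rewrite !linearD !linearZ_LR (Sg _ _ Sm) gu0.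
  move=> y; rewrite linearD linearZ_LR dsumDE dsumZE => h.
  apply: contrapT => /not_orP [nAy nyx]; apply: h.
  have -> : i m y = 0 by apply: contrapT => /(Ssupp _ _ _ Sm).
  have -> : i n0 y = 0 by apply: contrapT => /n0near [].
  by rewrite scaler0 addr0.
- move=> u [a [m [v [Sm m0 ->]]]].
  have : i (m + a *: n0) x = 0 by rewrite -m0 linear0.
  rewrite linearD linearZ_LR dsumDE dsumZE n0x (Sx _ _ Sm) add0r.
  move=> /eqP; rewrite -[a *: d]/(a * d) mulf_eq0 => /orP [] /eqP e.
    by move: m0 Sm; rewrite e !scale0r !addr0 => <- /Sfun.
  have [n00 u00] := d0 e; move: m0 Sm; rewrite n00 u00 !scaler0 !addr0 => <-.
  by move=> /Sfun.
- move=> n _ nB; have [a na] := dE _ nB.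
  have [|u Su] := Stot (n - a *: n0).
    move=> y; rewrite linearB linearZ_LR => h.
    have yx : y <> x.
      by move=> yx; apply: h; rewrite yx dsumDE na -scaleN1r dsumZE dsumZE n0x
        scaleN1r addrN.
    apply: contrapT => nAy; apply: h; rewrite dsumDE -scaleN1r !dsumZE.
    have -> : i n y = 0 by apply: contrapT => /nB [].
    have -> : i n0 y = 0 by apply: contrapT => /n0near [].
    by rewrite !scaler0 addr0.
  exists (u + a *: u0); exists a, (n - a *: n0), u; split=> //.
  by rewrite subrK.
Qed.

Lemma projective_submodule M N (i : {linear N -> M}) :
  principal_ideal_domain R -> projective M -> injective i -> projective N.
Proof.
move=> pid Mproj iinj; have [s sE] := projective_cover_split Mproj.
apply: (@projective_submodule_freeM _ _ (s \o i) pid) => x y /= e.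
by apply: iinj; rewrite -[i x]sE -[i y]sE e.
Qed.

Lemma is_free_projective M : is_free M -> projective M.
Proof.
move=> [B [Bfree Bspan]].
pose X : choiceType := {m : M | `[< B m >]}.
pose p : {linear freeM R X -> M} := free_lift (fun b : X => val b).
have pE b : p (fgen R b) = val b by rewrite /p free_lift_gen.
have dsin_fgen (b : X) (c : R^o) : @dsin R X (@regM R X) b c = c *: fgen R b.
  by rewrite /fgen -linearZ; congr dsin; apply/esym/mulr1.
have pinj u : p u = 0 -> u = 0.
  rewrite {1}(dsum_sum_dsin u) linear_sum => pu.
  (* Independence in [is_free] speaks of coefficient functions on all of [M], so the coordinates of
     [u] are extended by 0 off the basis. *)
  pose c (m : M) : R := if insub m is Some b then (u : dsum _) b else 0.
  have cE (b : X) : c (val b) = u b by rewrite /c valK.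
  have suniq : uniq [seq val b | b <- dsum_supp u].
    by rewrite map_inj_uniq ?fset_uniq //; apply: val_inj.
  have sB : {in [seq val b | b <- dsum_supp u], forall x, B x}.
    by move=> _ /mapP [b _ ->]; apply/asboolP/(valP b).
  have /(_ _)/= h := Bfree _ c suniq sB.
  apply: dsumP => b; apply: contrapT => ub; apply: (ub).
  rewrite -cE h //; last by apply: map_f; apply: dsum_suppP.
  rewrite big_map -[RHS]pu; apply: eq_bigr => b' _.
  by rewrite cE dsin_fgen linearZ_LR pE.
have [m|a m u m' u' -> ->|u /esym/pinj //|s sE] := @linear_choice M (freeM R X)
    (fun m u => m = p u).
- have [s [c [sB ->]]] := Bspan m.
  elim: s sB => [|x s IH] sB; first by exists 0; rewrite big_nil linear0.
  have [y ys|u uE] := IH; first by apply: sB; rewrite inE ys orbT.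
  have xB : `[< B x >] by apply/asboolP/sB; rewrite inE eqxx.
  exists (c x *: fgen R (exist _ x xB : X) + u).
  by rewrite big_cons linearP pE uE.
- by rewrite linearP.
- apply: (projective_retract (s := s) (t := p)) => [m|]; first exact/esym.
  exact: projective_freeM.
Qed.
End Projective.

(** * Exactness and flatness of tensor products *)

Section TensorExactness.
Variable R : idomainType.
Implicit Types M N U V K L P Q C D : lmodType R.

Lemma freeM_ind (X : choiceType) (S : freeM R X -> Prop) :
  S 0 -> (forall a u v, S u -> S v -> S (a *: u + v)) ->
  (forall x, S (fgen R x)) -> forall u, S u.
Proof.
move=> S0 SL Sg u; rewrite (dsum_sum_dsin u).
elim: (dsum_supp u : seq X) => [|x s IH]; first by rewrite big_nil.
rewrite big_cons.
have -> : @dsin R X (@regM R X) x (u x) = (u x : R) *: fgen R x.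
  by rewrite /fgen -linearZ; congr dsin; apply/esym/mulr1.
exact: SL.
Qed.

Lemma tens_ind M N (S : tensor M N -> Prop) :
  S 0 -> (forall a u v, S u -> S v -> S (a *: u + v)) ->
  (forall m n, S (tens m n)) -> forall t, S t.
Proof.
move=> S0 SL Sg t; rewrite -[t]qcl_repr; move: (repr t) => u.
elim/freeM_ind: u => [|a u v Su Sv|[m n]]; first by rewrite linear0.
  by rewrite linearP; apply: SL.
exact: Sg.
Qed.

Lemma tens_map_surj P Q C D (f : {linear P -> C}) (g : {linear Q -> D}) :
  (forall c, exists p, f p = c) -> (forall d, exists q, g q = d) ->
  forall t, exists u, tens_map f g u = t.
Proof.
move=> fsurj gsurj; move=> t; elim/tens_ind: t => [|a _ _ [u <-] [v <-]|c d].
- by exists 0; rewrite linear0.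
- by exists (a *: u + v); rewrite linearP.
- have [p <-] := fsurj c; have [q <-] := gsurj d.
  by exists (tens p q); rewrite tens_mapE.
Qed.

Lemma tensBl M N (m m' : M) (n : N) :
  tens (m - m') n = tens m n - tens m' n.
Proof.
by rewrite addrC -scaleN1r tens_linearl scaleN1r addrC.
Qed.

Lemma tensBr M N (m : M) (n n' : N) :
  tens m (n - n') = tens m n - tens m n'.
Proof.
by rewrite addrC -scaleN1r tens_linearr scaleN1r addrC.
Qed.

(** Right exactness in the form of an induction principle. Modulo the span of [W], the class of s c
    (x) r d does not depend on the set-theoretic sections [s] and [r]; it is therefore bilinear in c
    and d, and the quotient map [c0] factors through the tensor product of [f] and [g]. *)
Lemma tens_map_kernel P Q C D (f : {linear P -> C}) (g : {linear Q -> D})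
    (S : tensor P Q -> Prop) :
  (forall c, exists p, f p = c) -> (forall d, exists q, g q = d) ->
  S 0 -> (forall a u v, S u -> S v -> S (a *: u + v)) ->
  (forall p q, f p = 0 \/ g q = 0 -> S (tens p q)) ->
  forall t, tens_map f g t = 0 -> S t.
Proof.
move=> fsurj gsurj S0 SL Sg t.
pose W : set (tensor P Q) :=
  [set w | exists p q, (f p = 0 \/ g q = 0) /\ w = tens p q].
pose c0 := qcl (spanM W).
have [s sE] := choice fsurj; have [r rE] := choice gsurj.
have c0E p q p' q' : f p = f p' -> g q = g q' -> c0 (tens p q) = c0 (tens p' q').
  move=> fp gq; apply/qcl_eq.
  rewrite -(subrK (tens p' q) (tens p q)) -addrA -tensBl -tensBr.
  apply: rpredD; apply: mem_span.
    by exists (p - p'), q; split=> //; left; rewrite linearB fp subrr.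
  by exists p', (q - q'); split=> //; right; rewrite linearB gq subrr.
have bl d : linear (fun c => c0 (tens (s c) (r d))).
  move=> a x y; rewrite -[RHS]linearP -tens_linearl; apply: c0E => //.
  by rewrite linearP !sE.
have br c : linear (fun d => c0 (tens (s c) (r d))).
  move=> a x y; rewrite -[RHS]linearP -tens_linearr; apply: c0E => //.
  by rewrite linearP !rE.
have c0t u : c0 u = tens_lift bl br (tens_map f g u).
  apply: (tens_ext (g := c0) (h := tens_lift bl br \o tens_map f g)) => p q.
  rewrite -[RHS]/(tens_lift bl br (tens_map f g (tens p q))) tens_mapE tens_liftE.
  by apply: c0E; rewrite ?sE ?rE.
move=> t0; have /qcl_eq0/asboolP : c0 t = 0 by rewrite c0t t0 linear0.
by apply=> // _ [p [q [h ->]]]; apply: Sg.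
Qed.

Lemma tens_map_image_closed K L P Q (f : {linear K -> P}) (g : {linear L -> Q}) :
  (exists t, tens_map f g t = 0) /\
  forall a u v, (exists t, tens_map f g t = u) -> (exists t, tens_map f g t = v)
   -> exists t, tens_map f g t = a *: u + v.
Proof.
split; first by exists 0; rewrite linear0.
by move=> a _ _ [u <-] [v <-]; exists (a *: u + v); rewrite linearP.
Qed.

Lemma tens_exactl K P C D (i : {linear K -> P}) (p : {linear P -> C}) :
  (forall c, exists x, p x = c) -> (forall x, p x = 0 -> exists k, i k = x) ->
  forall t, tens_map p (idfun : {linear D -> D}) t = 0 ->
    exists k, tens_map i (idfun : {linear D -> D}) k = t.
Proof.
move=> psurj pex; have [h0 hL] := tens_map_image_closed i (idfun : {linear D -> D}).
apply: tens_map_kernel => // [d|x d []]; first by exists d.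
  by move=> /pex [k <-]; exists (tens k d); rewrite tens_mapE.
by move=> d0; have {d0}-> : d = 0 := d0; exists 0; rewrite linear0 tens0r.
Qed.

Lemma tens_exactr L Q D C (i : {linear L -> Q}) (p : {linear Q -> D}) :
  (forall c, exists x, p x = c) -> (forall x, p x = 0 -> exists k, i k = x) ->
  forall t, tens_map (idfun : {linear C -> C}) p t = 0 ->
    exists k, tens_map (idfun : {linear C -> C}) i k = t.
Proof.
move=> psurj pex; have [h0 hL] := tens_map_image_closed (idfun : {linear C -> C}) i.
apply: tens_map_kernel => // [d|c x []]; first by exists d.
  by move=> c0; have {c0}-> : c = 0 := c0; exists 0; rewrite linear0 tens0l.
by move=> /pex [k <-]; exists (tens c k); rewrite tens_mapE.
Qed.

(** * Coordinates on a tensor product with a free module *)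

Section Coordinates.
Variables (X : choiceType) (L : lmodType R) (x : X).

Let coord_bil l : linear (fun u : freeM R X => (u x : R) *: (l : L)).
Proof. by move=> a u v; rewrite dsumDE dsumZE scalerDl scalerA. Qed.

Let coord_bir (u : freeM R X) : linear (fun l : L => (u x : R) *: l).
Proof. by move=> a l l'; rewrite scalerDr !scalerA mulrC. Qed.

Definition tens_coord : {linear tensor (freeM R X) L -> L} :=
  tens_lift coord_bil coord_bir.

Lemma tens_coordE u l : tens_coord (tens u l) = (u x : R) *: l.
Proof. exact: tens_liftE. Qed.
End Coordinates.

Lemma tens_coord_natural (X : choiceType) L Q (i : {linear L -> Q}) (x : X) t :
  tens_coord _ x (tens_map (idfun : {linear freeM R X -> freeM R X}) i t) =
  i (tens_coord _ x t).
Proof.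
apply: (tens_ext (g := tens_coord _ x \o tens_map idfun i)
  (h := i \o tens_coord _ x)) => u l.
rewrite -[LHS]/(tens_coord Q x (tens_map _ i (tens u l))).
by rewrite -[RHS]/(i (tens_coord _ x (tens u l))) tens_mapE !tens_coordE linearZ_LR.
Qed.

(** The map [phi] from a direct sum of copies of [L] is onto, and the coordinates of [phi y] are the
    components of [y]. This settles the claim without constructing an inverse of [phi]. *)
Lemma tens_coord_inj (X : choiceType) L (t : tensor (freeM R X) L) :
  (forall x, tens_coord _ x t = 0) -> t = 0.
Proof.
pose T (_ : X) := L.
have tl x : linear (fun l : T x => tens (fgen R x) l) by apply: tens_linearr.
pose phi : {linear dsum T -> tensor (freeM R X) L} :=
  @dsum_lift R X T (tensor (freeM R X) L) (fun x => linear_of (tl x)).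
have phiE x (l : T x) : phi (@dsin R X T x l) = tens (fgen R x) l.
  pose F x : {linear T x -> tensor (freeM R X) L} := linear_of (tl x).
  exact (@dsum_lift_dsin R X T _ F x l).
have [y <-] : exists y, phi y = t.
  elim/tens_ind: t => [|a _ _ [u <-] [v <-]|u l].
  - by exists 0; rewrite linear0.
  - by exists (a *: u + v); rewrite linearP.
  - elim/freeM_ind: u => [|a u v [y yE] [z zE]|x].
    + by exists 0; rewrite linear0 tens0l.
    + by exists (a *: y + z); rewrite linearP tens_linearl yE zE.
    + by exists (@dsin R X T x l); rewrite phiE.
have coordE x : tens_coord _ x (phi y) = y x.
  have ylin : linear (fun y : dsum T => y x) by [].
  apply: (dsum_ext (g := tens_coord _ x \o phi) (h := linear_of ylin)) => x' l.
  rewrite -[LHS]/(tens_coord _ x (phi (@dsin R X T x' l))) -[RHS]/(@dsin R X T x' l x).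
  rewrite phiE tens_coordE /fgen /=.
  have [<-|xx] := eqVneq x' x; first by rewrite !eqtype.dfwith_in scale1r.
  by rewrite !eqtype.dfwith_out // scale0r.
by move=> h; rewrite (_ : y = 0) ?linear0 //; apply: dsumP => x; rewrite -coordE h.
Qed.

(** A section of the free cover makes M (x) L a retract of its analogue for the free module on [M],
    where coordinates are natural in the second factor and detect zero. *)
Lemma projective_flat M L Q (i : {linear L -> Q}) : projective M ->
  (forall l, i l = 0 -> l = 0) ->
  forall t, tens_map (idfun : {linear M -> M}) i t = 0 -> t = 0.
Proof.
move=> Mproj i0 t t0; have [s sE] := projective_cover_split Mproj.
pose st := tens_map s (idfun : {linear L -> L}) t.
have stE : tens_map (free_cover M) (idfun : {linear L -> L}) st = t.
  rewrite /st tens_map_comp -[RHS]tens_map_id.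
  by apply: tens_map_ext => // m /=; rewrite sE.
rewrite -stE (_ : st = 0) ?linear0 //; apply: tens_coord_inj => x; apply: i0.
rewrite -tens_coord_natural /st tens_map_comp.
rewrite (@tens_map_ext _ _ _ _ _ _ (s \o idfun) _ (idfun \o i)) //.
by rewrite -tens_map_comp t0 !linear0.
Qed.

(* Two maps of resolutions over the same map of modules differ by a map
   [s : P -> N], which annihilates the kernel of [K (x) D -> P (x) D]. *)
Lemma tor_lift_unique K P N Q C' D D' (i : {linear K -> P})
    (j : {linear N -> Q}) (q : {linear Q -> C'}) (f f' : {linear K -> N})
    (g g' : {linear P -> Q}) (h : {linear D -> D'}) :
  projective P -> injective j -> (forall y, q y = 0 -> exists n, j n = y) ->
  (forall k, j (f k) = g (i k)) -> (forall k, j (f' k) = g' (i k)) ->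
  (forall x, q (g x) = q (g' x)) ->
  forall t, tens_map i (idfun : {linear D -> D}) t = 0 ->
    tens_map f h t = tens_map f' h t.
Proof.
move=> Pproj jinj qex jf jf' qg t t0.
have [|s sE] := Pproj _ _ j (g \- g').
  by move=> x; apply: qex; rewrite /= linearB qg subrr.
have e : tens_map (s \o i) h t = 0.
  by rewrite -(@tens_map_comp _ _ _ _ _ _ _ i s idfun h t) t0 linear0.
suff : tens_map f h t = tens_map f' h t + tens_map (s \o i) h t by rewrite e addr0.
apply: (tens_ext (g := tens_map f h)
  (h := tens_map f' h \+ tens_map (s \o i) h)) => k d.
rewrite -[RHS]/(tens_map f' h (tens k d) + tens_map (s \o i) h (tens k d)).
rewrite !tens_mapE; suff -> : f k = 1 *: f' k + s (i k).
  by rewrite tens_linearl scale1r.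
by apply: jinj; rewrite scale1r linearD jf jf' sE /= addrC subrK.
Qed.
End TensorExactness.

(** * Total complexes and tensor complexes *)

Section TotalMaps.
Variables (R : idomainType) (F : bifunctor R).

Lemma tot_map_preimage (A A' B B' : complex R) (f : chain_map A A')
    (g : chain_map B B') n (y : tot F A' B' n) :
  (forall i j, exists x, bi_map F (f i) (g j) x = tot_comp y i j) ->
  exists x, tot_map F f g n x = y.
Proof.
move=> h.
(* The preimage is chosen to be 0 wherever the component of [y] is 0, which keeps the support of the
   assembled element finite. *)
have {}h (p : tot_idx n) : exists x : tot_term F A B p,
    bi_map F (f (val p).1) (g (val p).2) x = (y : dsum _) p /\
    ((y : dsum _) p = 0 -> x = 0).
  have [x xE] := h (val p).1 (val p).2; rewrite tot_comp_idx in xE.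
  have [y0|/eqP y0] := eqVneq ((y : dsum _) p) 0; last by exists x.
  by exists 0; rewrite linear0 y0.
pose x p := projT1 (cid (h p)).
have xfin : finite_set [set p | x p <> 0].
  apply: sub_finite_set (dsum_finite y) => p /= xp yp; apply: xp.
  by rewrite /x; case: (cid (h p)) => u [_] /= ->.
exists (@DSum R _ (@tot_term R F A B n) x xfin); apply: dsumP => p /=.
by rewrite /x; case: (cid (h p)) => u [].
Qed.

Lemma tot_map_eq0 (A A' B B' : complex R) (f : chain_map A A')
    (g : chain_map B B') n (x : tot F A B n) :
  tot_map F f g n x = 0 <->
  forall i j, bi_map F (f i) (g j) (tot_comp x i j) = 0.
Proof.
split=> [x0 i j|x0]; first by rewrite -tot_comp_map -[RHS](tot_comp0 F A' B' n i j) -x0.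
by apply: tot_ext => i j _; rewrite tot_comp_map x0 tot_comp0.
Qed.
End TotalMaps.

Section TensorComplexMaps.
Variable R : idomainType.
Implicit Types P Q : complex R.

Lemma tensor_complex_ext P Q n (V : lmodType R)
    (g h : {linear tensor_complex P Q n -> V}) :
  (forall i j (e : i + j = n) (x : P i) (y : Q j),
     g (ctens e x y) = h (ctens e x y)) -> g =1 h.
Proof.
move=> gh; apply: dsum_ext => -[[i j] ij] t.
pose k := @tot_inj R (tensor_bifunctor R) P Q n (exist _ (i, j) ij).
apply: (tens_ext (g := g \o k) (h := h \o k)) => x y /=.
have := gh i j (eqP ij) x y; rewrite /ctens /tot_in.
by rewrite (bool_irrelevance (introT eqP _) ij).
Qed.

Section Lift.
Variables (P Q : complex R) (n : int) (V : lmodType R).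
Variable b : forall i j, i + j = n -> {linear tensor (P i) (Q j) -> V}.

Definition tensor_complex_lift : {linear tensor_complex P Q n -> V} :=
  @dsum_lift R _ (@tot_term R (tensor_bifunctor R) P Q n) V
    (fun p => b (eqP (valP p)) : {linear tot_term (tensor_bifunctor R) P Q p -> V}).

Lemma tensor_complex_liftE i j (e : i + j = n) (x : P i) (y : Q j) :
  tensor_complex_lift (ctens e x y) = b e (tens x y).
Proof.
rewrite /tensor_complex_lift /ctens /tot_in /tot_inj.
apply: (etrans (dsum_lift_dsin _ _)).
by rewrite /= (Prop_irrelevance (eqP _) e).
Qed.
End Lift.

Lemma tensor_chain_mapE P P' Q Q' (f : chain_map P P') (g : chain_map Q Q')
    n i j (e : i + j = n) (x : P i) (y : Q j) :
  tensor_chain_map f g n (ctens e x y) = ctens e (f i x) (g j y).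
Proof.
apply: tot_ext => i' j' _; rewrite tot_comp_map.
have [[ii jj]|ij] := eqVneq (i, j) (i', j').
  by subst i' j'; rewrite !tot_comp_in; apply: tens_mapE.
by rewrite !tot_comp_in_out // linear0.
Qed.

(** The Leibniz rule, with all degrees as variables tied by equations so that it can be rewritten
    with whatever the syntactic form of the degrees. *)
Lemma cdiff_ctens P Q m n i j i' j' (e : i + j = m) (e1 : i' + j = n)
    (e2 : i + j' = n) (x : P i) (y : Q j) : m = n + 1 ->
  cdiff (tensor_complex P Q) m n (ctens e x y) =
  ctens e1 (cdiff P i i' x) y + (-1) ^ i *: ctens e2 x (cdiff Q j j' y).
Proof.
move=> mn.
have ii : i = i' + 1 by apply: (addIr j); rewrite e mn addrAC e1.
have jj : j = j' + 1 by apply: (addrI i); rewrite e mn addrA e2.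
subst i j; apply: tot_ext => a b ab; rewrite tot_comp_diff // /tot_diff_comp.
rewrite [ctens e1 _ _ + _]addrC tot_comp_linear [RHS]addrC; congr (_ + _).
  have [[<- <-]|ab'] := eqVneq (i', j' + 1) (a, b).
    by rewrite !tot_comp_in; apply: tens_mapE.
  rewrite !tot_comp_in_out ?linear0 //.
  by apply: contra_neq ab' => -[/addIr -> ->].
have [[<- <-]|ab'] := eqVneq (i' + 1, j') (a, b).
  by rewrite !tot_comp_in; congr (_ *: _); apply: tens_mapE.
rewrite !tot_comp_in_out ?linear0 ?scaler0 //.
by apply: contra_neq ab' => -[-> /addIr ->].
Qed.
End TensorComplexMaps.

(** * Contractions *)

Section Cast.
Variables (R : idomainType) (T : int -> lmodType R).

(** Being 0 between distinct degrees makes the cast total and linear; it extends differentials given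
    in successive degrees to the maps between all pairs of degrees that [complex] asks for. *)
Definition cast_fun m n (x : T m) : T n :=
  if m =P n is ReflectT e then ecast k (T k) e x else 0.

Lemma cast_linear m n : linear (@cast_fun m n).
Proof.
rewrite /cast_fun; case: eqP => [e|_] a x y; last by rewrite scaler0 addr0.
by case: n / e.
Qed.

Definition castM m n : {linear T m -> T n} := linear_of (@cast_linear m n).

Lemma castM_id m x : castM m m x = x.
Proof. by rewrite /= /cast_fun; case: eqP => // e; rewrite eq_axiomK. Qed.

Lemma castM_neq m n x : m != n -> castM m n x = 0.
Proof. by rewrite /= /cast_fun; case: eqP. Qed.

Variable d : forall n, {linear T (n + 1) -> T n}.
Hypothesis dd : forall n x, d n (d (n + 1) x) = 0.

Let diff m n : {linear T m -> T n} := d n \o castM m (n + 1).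

Let diff_shape m n (x : T m) : m != n + 1 -> diff m n x = 0.
Proof.
move=> mn; rewrite -[LHS]/(d n (castM m (n + 1) x)) castM_neq //.
exact: linear0.
Qed.

Let diff_diff m n p (x : T m) : diff n p (diff m n x) = 0.
Proof.
have [np|] := eqVneq n (p + 1); last exact: diff_shape.
subst n; rewrite -[LHS]/(d p (castM (p + 1) (p + 1) (diff m (p + 1) x))).
by rewrite castM_id dd.
Qed.

Definition complex_of : complex R := Complex diff_shape diff_diff.

Lemma complex_ofE n (x : T (n + 1)) : cdiff complex_of (n + 1) n x = d n x.
Proof.
by rewrite -[LHS]/(d n (castM (n + 1) (n + 1) x)) castM_id.
Qed.
End Cast.

Section ComplexTools.
Variable R : idomainType.
Implicit Types A B C D E F K P Q : complex R.

Section ChainMapOf.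
Variables (A B : complex R) (f : forall n, {linear A n -> B n}).
Hypothesis fd : forall n (x : A (n + 1)),
  f n (cdiff A (n + 1) n x) = cdiff B (n + 1) n (f (n + 1) x).

Let chain_map_of_subproof m n (x : A m) :
  f n (cdiff A m n x) = cdiff B m n (f m x).
Proof.
have [mn|mn] := eqVneq m (n + 1); first by subst m; apply: fd.
by rewrite !cdiff_shape // linear0.
Qed.

Definition chain_map_of : chain_map A B := ChainMap chain_map_of_subproof.
End ChainMapOf.

Section KernelComplex.
Variables (A B : complex R) (f : chain_map A B).

Lemma ker_complex_subproof m n (x : A m) : f m x = 0 -> f n (cdiff A m n x) = 0.
Proof. by move=> x0; rewrite cmap_diff x0 linear0. Qed.

Let diff m n : {linear kerM (f m) -> kerM (f n)} :=
  ker_map (@ker_complex_subproof m n).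

Let diff_shape m n x : m != n + 1 -> diff m n x = 0.
Proof. by move=> mn; apply: val_inj; apply: cdiff_shape. Qed.

Let diff_diff m n p x : diff n p (diff m n x) = 0.
Proof. by apply: val_inj; apply: cdiff_diff. Qed.

Definition ker_complex : complex R :=
  @Complex R (fun n => kerM (f n)) diff diff_shape diff_diff.

Let inc n : {linear ker_complex n -> A n} := (val : kerM (f n) -> A n).

Definition ker_inc : chain_map ker_complex A :=
  @ChainMap R ker_complex A inc (fun m n x => erefl).

Lemma ker_inc_inj n : injective (ker_inc n).
Proof. exact: val_inj. Qed.

Lemma ker_inc0 n x : f n (ker_inc n x) = 0.
Proof. exact: kerM_valE. Qed.

Lemma ker_inc_exact n x : f n x = 0 -> exists k, ker_inc n k = x.
Proof. by move=> /eqP x0; exists (@KerM R _ _ (f n) x x0). Qed.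
End KernelComplex.

Definition is_cycle A n (x : A n) : Prop := forall k, cdiff A n k x = 0.

Definition is_boundary A n (x : A n) : Prop :=
  exists y : A (n + 1), cdiff A (n + 1) n y = x.

Definition elt_acyclic A : Prop := forall n (x : A n), is_cycle x -> is_boundary x.

(** Injectivity on homology, phrased on elements to suit diagram chases. *)
Definition reflects_boundaries A B (f : chain_map A B) : Prop :=
  forall n (x : A n), is_cycle x -> is_boundary (f n x) -> is_boundary x.

Lemma is_cycleP A n (x : A n) : cdiff A n (n - 1) x = 0 -> is_cycle x.
Proof. by move=> x0 k; apply: (cycleE (Cycle x0)). Qed.

Definition contraction E (h : forall m n, {linear E m -> E n}) : Prop :=
  forall k m n, m = k + 1 -> n = m + 1 -> forall x : E m,
    cdiff E n m (h m n x) + h k m (cdiff E m k x) = x.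

(** The cycles are submodules of projectives, hence projective, so the differential onto them has a
    section [s]. Then [p], which is 1 - s d, projects onto the cycles and s p is the contraction.
    Each degree is treated on its own, so unbounded complexes cause no difficulty. *)
Lemma acyclic_projective_contraction E : principal_ideal_domain R ->
  (forall n, projective (E n)) -> elt_acyclic E -> exists h, @contraction E h.
Proof.
move=> pid Eproj Eac.
have sP m n : exists s : {linear cycles E m -> E n}, n = m + 1 ->
    forall z, cdiff E n m (s z) = val z.
  have [->|/eqP nm] := eqVneq n (m + 1); last first.
    by exists (\0 : {linear cycles E m -> E n}).
  have inj : injective (val : cycles E m -> E m) by apply: val_inj.
  have Zproj := projective_submodule (i := val : {linear cycles E m -> E m})
    pid (Eproj m) inj.
  have [z|s sE] := Zproj _ _ (cdiff E (m + 1) m) (val : {linear cycles E m -> E m}).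
    by apply: Eac => k; apply: cycleE.
  by exists s.
pose s m n := projT1 (cid (sP m n)).
have sE m n z : n = m + 1 -> cdiff E n m (s m n z) = val z.
  by rewrite /s; case: (cid (sP m n)) => t /= tE /tE.
have dlin m k : linear (fun x : E m => Cycle (cdiff_diff k (k - 1) x)).
  by move=> a x y; apply: val_inj; rewrite /= linearP.
pose d m k : {linear E m -> cycles E k} := linear_of (dlin m k).
have pP m : exists p : {linear E m -> cycles E m},
    forall x, val (p x) = x - s (m - 1) m (d m (m - 1) x).
  have [x|p pE] := Eproj m _ _ (val : {linear cycles E m -> E m})
      (idfun \- (s (m - 1) m \o d m (m - 1))); last by exists p.
  have c : cdiff E m (m - 1) (x - s (m - 1) m (d m (m - 1) x)) = 0.
    by rewrite linearB sE ?subrK //= subrr.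
  by exists (Cycle c).
pose p m := projT1 (cid (pP m)).
have pE m x : val (p m x) = x - s (m - 1) m (d m (m - 1) x).
  by rewrite /p; case: (cid (pP m)) => q /= ->.
exists (fun m n => s m n \o p m) => k m n mk nm x.
have km : k = m - 1 by rewrite mk addrK.
rewrite -[X in X + _]/(cdiff E n m (s m n (p m x))) sE // pE -km.
rewrite -[X in _ + X]/(s k m (p k (cdiff E m k x))).
(* The projection [p] fixes cycles, in particular the boundary of [x]. *)
suff -> : s k m (p k (cdiff E m k x)) = s k m (d m k x) by rewrite subrK.
congr (s k m _); apply: val_inj.
have d0 : d k (k - 1) (cdiff E m k x) = 0 by apply: val_inj; apply: cdiff_diff.
by rewrite pE d0 linear0 subr0.
Qed.

(** The homotopy h (x) 1 needs no sign: the two terms h x (x) dy arise with (-1)^(i+1) and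
    (-1)^i. *)
Lemma contraction_tensorl K D h :
  @contraction K h -> elt_acyclic (tensor_complex K D).
Proof.
move=> hE.
have deg (m m' i j : int) : m' = m + 1 -> i + j = m -> i + 1 + j = m'.
  by move=> -> <-; rewrite addrAC.
pose H m m' (mm : m' = m + 1) : {linear tensor_complex K D m -> tensor_complex K D m'} :=
  tensor_complex_lift (fun i j (e : i + j = m) =>
    tot_in (tensor_bifunctor R) K D (deg _ _ _ _ mm e)
      \o tens_map (h i (i + 1)) (idfun : {linear D j -> D j})).
have HE m m' mm (i i' j : int) (e : i + j = m) (e' : i' + j = m') x y :
    H m m' mm (ctens e x y) = ctens e' (h i i' x) y.
  have ii : i' = i + 1 by apply: (addIr j); rewrite e' mm -e addrAC.
  subst i'; apply: (etrans (tensor_complex_liftE _ _ _ _)).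
  rewrite /ctens -(tens_mapE (h i (i + 1)) idfun).
  by rewrite (Prop_irrelevance (deg _ _ _ _ mm e) e').
have hH k m n (mk : m = k + 1) (nm : n = m + 1) (x : tensor_complex K D m) :
    cdiff (tensor_complex K D) n m (H m n nm x) +
      H k m mk (cdiff (tensor_complex K D) m k x) = x.
  apply: (tensor_complex_ext
    (g := (cdiff _ n m \o H m n nm) \+ (H k m mk \o cdiff _ m k))
    (h := idfun)) => i j e {}x y.
  rewrite -[LHS]/(cdiff (tensor_complex K D) n m (H m n nm (ctens e x y)) +
      H k m mk (cdiff (tensor_complex K D) m k (ctens e x y))).
  have e1 : i + 1 + j = n by rewrite nm -e addrAC.
  have e2 : i + 1 + (j - 1) = m by rewrite addrACA addrN addr0.
  have e3 : i - 1 + j = k by apply: (addIr 1); rewrite -mk -e addrAC subrK.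
  have e4 : i + (j - 1) = k by apply: (addIr 1); rewrite -mk -e -addrA subrK.
  rewrite (HE _ _ _ _ _ _ _ e1) (cdiff_ctens e1 e e2) // (cdiff_ctens e e3 e4) //.
  rewrite linearD linearZ_LR (HE _ _ _ _ _ _ _ e) (HE _ _ _ _ _ _ _ e2).
  rewrite addrACA -scalerDl exprzDr ?unitrN1 // mulrN1 addNr scale0r addr0.
  have := ctens_linearl e y 1 (cdiff K (i + 1) i (h i (i + 1) x)).
  move=> /(_ (h (i - 1) i (cdiff K i (i - 1) x))); rewrite !scale1r => <-.
  by rewrite hE // subrK.
move=> n x xc.
have nn : n = n - 1 + 1 by rewrite subrK.
exists (H n (n + 1) erefl x); rewrite -[RHS](hH (n - 1) n (n + 1) nn erefl).
by rewrite xc linear0 addr0.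
Qed.

(** Here the homotopy moves past the first factor; the sign [(-1) ^ i] makes the two terms dx (x) h
    y cancel. *)
Lemma contraction_tensorr D K h :
  @contraction K h -> elt_acyclic (tensor_complex D K).
Proof.
move=> hE.
have deg (m m' i j : int) : m' = m + 1 -> i + j = m -> i + (j + 1) = m'.
  by move=> -> <-; rewrite addrA.
pose H m m' (mm : m' = m + 1) : {linear tensor_complex D K m -> tensor_complex D K m'} :=
  tensor_complex_lift (fun i j (e : i + j = m) =>
    (-1) ^ i \*: (tot_in (tensor_bifunctor R) D K (deg _ _ _ _ mm e)
      \o tens_map (idfun : {linear D i -> D i}) (h j (j + 1)))).
have HE m m' mm (i j j' : int) (e : i + j = m) (e' : i + j' = m') x y :
    H m m' mm (ctens e x y) = (-1) ^ i *: ctens e' x (h j j' y).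
  have jj : j' = j + 1 by apply: (addrI i); rewrite e' mm -e addrA.
  subst j'; apply: (etrans (tensor_complex_liftE _ _ _ _)).
  rewrite /ctens -(tens_mapE idfun (h j (j + 1))).
  by rewrite (Prop_irrelevance (deg _ _ _ _ mm e) e').
have hH k m n (mk : m = k + 1) (nm : n = m + 1) (x : tensor_complex D K m) :
    cdiff (tensor_complex D K) n m (H m n nm x) +
      H k m mk (cdiff (tensor_complex D K) m k x) = x.
  apply: (tensor_complex_ext
    (g := (cdiff _ n m \o H m n nm) \+ (H k m mk \o cdiff _ m k))
    (h := idfun)) => i j e {}x y.
  rewrite -[LHS]/(cdiff (tensor_complex D K) n m (H m n nm (ctens e x y)) +
      H k m mk (cdiff (tensor_complex D K) m k (ctens e x y))).
  have sgn : (-1) ^ i = - (-1) ^ (i - 1) :> R.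
    by rewrite -[in LHS](subrK 1 i) [LHS]exprzDr ?unitrN1 // expr1z mulrN1.
  have e1 : i + (j + 1) = n by rewrite nm -e addrA.
  have e2 : i - 1 + (j + 1) = m by rewrite addrACA addNr addr0.
  have e3 : i - 1 + j = k by apply: (addIr 1); rewrite -mk -e addrAC subrK.
  have e4 : i + (j - 1) = k by apply: (addIr 1); rewrite -mk -e -addrA subrK.
  rewrite (HE _ _ _ _ _ _ _ e1) linearZ_LR (cdiff_ctens e1 e2 e) //.
  rewrite (cdiff_ctens e e3 e4) //.
  rewrite [H _ _ _ (_ + _)]linearD [H _ _ _ (_ *: _)]linearZ_LR.
  rewrite (HE _ _ _ _ _ _ _ e2) (HE _ _ _ _ _ _ _ e).
  rewrite scalerDr !scalerA -!exprzMl ?unitrN1 // mulrNN mulr1 exp1rz !scale1r.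
  rewrite addrACA -scalerDl sgn addNr scale0r add0r.
  have := ctens_linearr e x 1 (cdiff K (j + 1) j (h j (j + 1) y)).
  move=> /(_ (h (j - 1) j (cdiff K j (j - 1) y))); rewrite !scale1r => <-.
  by rewrite hE // subrK.
move=> n x xc.
have nn : n = n - 1 + 1 by rewrite subrK.
exists (H n (n + 1) erefl x); rewrite -[RHS](hH (n - 1) n (n + 1) nn erefl).
by rewrite xc linear0 addr0.
Qed.
End ComplexTools.

(** * Resolutions and the Tor complex *)

(** In the main application [i] is K (x) D -> P (x) D and its kernel is the Tor complex. If p j x =
    d p y', then j x - d y' = i k, and dk is a cycle killed by [i], so dk = dt with i t = 0. The
    cycle k - t is some dw, whence j x = d (i w + y'), and [rho] brings this back to [X]. *)
Lemma boundary_chase (R : idomainType) (X P K Y : complex R)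
    (j : chain_map X P) (rho : chain_map P X) (p : chain_map P Y)
    (i : chain_map K P) :
  (forall n x, rho n (j n x) = x) ->
  (forall n y, exists x, p n x = y) ->
  (forall n x, p n x = 0 -> exists k, i n k = x) ->
  (forall n k, p n (i n k) = 0) ->
  elt_acyclic K ->
  (forall n (k : K n), i n k = 0 -> is_cycle k ->
     exists t, i (n + 1) t = 0 /\ cdiff K (n + 1) n t = k) ->
  forall n (x : X n), is_cycle x -> is_boundary (p n (j n x)) -> is_boundary x.
Proof.
move=> rj psurj pex pi Kac Tac n x xc [y yE].
have [y' y'E] := psurj _ y; subst y.
have [|k kE] := pex n (j n x - cdiff P (n + 1) n y').
  by rewrite linearB cmap_diff yE subrr.
move: (n - 1) (subrK 1 n) => m mn; subst n.
have [||t [t0 tk]] := Tac m (cdiff K (m + 1) m k).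
- by rewrite cmap_diff kE linearB -cmap_diff xc cdiff_diff linear0 subrr.
- by move=> l; apply: cdiff_diff.
have [|w wE] := Kac _ (k - t).
  apply: is_cycleP; have -> : m + 1 - 1 = m by rewrite addrK.
  by rewrite linearB tk subrr.
exists (rho _ (i _ w + y')).
rewrite -cmap_diff linearD -cmap_diff wE linearB t0 subr0 kE subrK.
exact: rj.
Qed.

Lemma free_cover_gen (R : idomainType) (M : lmodType R) (m : M) :
  free_cover M (fgen R m) = m.
Proof. exact: free_lift_gen. Qed.

Section QuasiIsomorphism.
Variables (R : idomainType) (A B : complex R) (f : chain_map A B).
Hypothesis qi : quasi_isomorphism f.

Lemma quasi_isomorphism_reflects : reflects_boundaries f.
Proof.
move=> n x xc [y yE]; pose z := Cycle (xc (n - 1)).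
have [g gf _] := qi n.
have : hclass A n z = hclass A n 0.
  apply: (can_inj gf); rewrite !homology_mapE; apply/hclass_eq; exists y.
  by rewrite yE linear0 subr0.
by move=> /hclass_eq [w wE]; exists w; rewrite wE subr0.
Qed.

Lemma quasi_isomorphism_lift n (y : B n) : is_cycle y ->
  exists x : A n, is_cycle x /\ is_boundary (y - f n x).
Proof.
move=> yc; have [g _ fg] := qi n.
have := fg (hclass B n (Cycle (yc (n - 1)))).
have [x <-] := hclass_surj (g (hclass B n (Cycle (yc (n - 1))))).
rewrite homology_mapE => /esym/hclass_eq [w wE].
by exists (val x); split; [apply: cycleE|exists w].
Qed.
End QuasiIsomorphism.

Lemma acyclic_elt (R : idomainType) (A : complex R) : acyclic A -> elt_acyclic A.
Proof.
move=> Aac n x xc.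
have /hclass_eq [w wE] : hclass A n (Cycle (xc (n - 1))) = hclass A n 0.
  by rewrite [LHS]Aac linear0.
by exists w; rewrite wE subr0.
Qed.

Section Resolution.
Variables (R : idomainType) (F C : complex R) (eta : chain_map F C).

(* The contractible complex generated by the elements [c] of [C] and formal
   differentials [d c], added to [F] so that the map to [C] becomes onto. *)
Let T n : lmodType R := (freeM R (C n) * freeM R (C (n + 1)%R) * F n)%type.

Let dfun n (x : T (n + 1)) : T n := (0, x.1.1, cdiff F (n + 1) n x.2).

Let dlin n : linear (@dfun n).
Proof.
move=> a x y; rewrite -[RHS]/(_, _, _) /= -(linearP (cdiff F _ _)) scaler0 addr0.
by [].
Qed.

Let ddiff n x : linear_of (@dlin n) (linear_of (@dlin (n + 1)) x) = 0.
Proof. by rewrite /= /dfun /= cdiff_diff. Qed.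

Definition cover_complex : complex R := complex_of ddiff.

Let pfun n (x : cover_complex n) : C n :=
  free_cover (C n) x.1.1 + cdiff C (n + 1) n (free_cover (C (n + 1)) x.1.2) +
  eta n x.2.

Let plin n : linear (@pfun n).
Proof.
move=> a x y; rewrite /pfun -!/(_ x) /= !linearP !scalerDr.
by rewrite [RHS]addrACA; congr (_ + _); apply: addrACA.
Qed.

Let pdiff n (x : cover_complex (n + 1)) :
  linear_of (@plin n) (cdiff cover_complex (n + 1) n x) =
  cdiff C (n + 1) n (linear_of (@plin (n + 1)) x).
Proof.
rewrite complex_ofE /= /pfun /= linear0 add0r !linearD cdiff_diff addr0.
by rewrite cmap_diff.
Qed.

Definition cover_map : chain_map cover_complex C := chain_map_of pdiff.

Let jlin n : linear (fun x : F n => ((0, 0, x) : cover_complex n)).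
Proof.
by move=> a x y; rewrite -[RHS]/(_, _, _) /= !scaler0 !addr0.
Qed.

Let jdiff n (x : F (n + 1)) :
  linear_of (@jlin n) (cdiff F (n + 1) n x) =
  cdiff cover_complex (n + 1) n (linear_of (@jlin (n + 1)) x).
Proof. by rewrite complex_ofE. Qed.

Definition cover_in : chain_map F cover_complex := chain_map_of jdiff.

Let rfun n : {linear cover_complex n -> F n} := (snd : T n -> F n).

Let rdiff n (x : cover_complex (n + 1)) :
  rfun n (cdiff cover_complex (n + 1) n x) =
  cdiff F (n + 1) n (rfun (n + 1) x).
Proof. by rewrite complex_ofE. Qed.

Definition cover_out : chain_map cover_complex F := chain_map_of rdiff.

Lemma cover_map_in n x : cover_map n (cover_in n x) = eta n x.
Proof. by rewrite /= /pfun /= !linear0 !add0r. Qed.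

Lemma cover_map_surj n c : exists x, cover_map n x = c.
Proof.
have [u <-] := free_cover_surj c.
by exists (u, 0, 0); rewrite /= /pfun /= !linear0 !addr0.
Qed.

Lemma cover_complex_projective :
  (forall n, projective (F n)) -> forall n, projective (cover_complex n).
Proof.
by move=> Fproj n; do !apply: projective_pair; auto; apply: projective_freeM.
Qed.

(** Write v also for its value in C. A cycle of the kernel is (0, v, x) with eta x = - dv.
    Injectivity of [eta] on homology gives x = d x1; surjectivity gives a cycle x2 with v + eta x1 -
    eta x2 = dw. Then (v, -w, x1 - x2) lies in the kernel, with differential (0, v, x). *)
Lemma ker_cover_acyclic : quasi_isomorphism eta -> elt_acyclic (ker_complex cover_map).
Proof.
move=> qi n k kc; move: (n - 1) (subrK 1 n) => m mn; subst n.
have := congr1 val (kc m); have := ker_inc0 k; move: (ker_inc_inj (f := cover_map)).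
case: k {kc} => -[[u v] x] kker inj.
rewrite -[ker_inc _ _ _]/(u, v, x) => k0.
rewrite -[val _]/(cdiff cover_complex (m + 1) m (u, v, x)).
rewrite complex_ofE => -[/= u0 x0]; subst u.
move: k0; rewrite /= /pfun /= linear0 add0r => /eqP; rewrite addr_eq0 => /eqP k0.
have xc : is_cycle x by apply: is_cycleP; rewrite addrK.
have [|x1 x1E] := quasi_isomorphism_reflects qi xc.
  by exists (- free_cover (C (m + 1 + 1)) v); rewrite linearN k0 opprK.
have [|x2 [x2c [w wE]]] :=
  quasi_isomorphism_lift qi (y := free_cover (C (m + 1 + 1)) v + eta _ x1).
  by apply: is_cycleP; rewrite addrK linearD -cmap_diff x1E k0 addNr.
have k'0 : cover_map (m + 1 + 1) (v, fgen R (- w), x1 - x2) = 0.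
  rewrite /= /pfun /= free_cover_gen linearN wE [eta _ (_ - _)]linearB.
  have e (V : zmodType) (a b c : V) : a - (a + b - c) + (b - c) = 0.
    by rewrite -(addrA a b) [- (a + _)]opprD addNKr addNr.
  exact: e.
have [k' k'E] := ker_inc_exact k'0; exists k'; apply: inj.
rewrite cmap_diff k'E complex_ofE /=.
by rewrite /dfun /= linearB x1E x2c subr0.
Qed.
End Resolution.

(** * Comparison of an arbitrary projective cover with the functorial one *)

Section TorComparison.
Variables (R : idomainType) (P C D : complex R) (p : chain_map P C).
Hypothesis Pproj : forall n, projective (P n).
Hypothesis psurj : forall n c, exists x, p n x = c.
Let K := ker_complex p.
Let i : chain_map K P := ker_inc p.

(** The comparison maps are chosen independently in each degree, so they need not commute with the
    differentials. By [tor_lift_unique], their restrictions [a] and [b] to the kernels do so after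
    tensoring, on the elements that represent Tor. *)
Let toP_ex n : exists a : {linear freeM R (C n) -> P n},
  forall u, p n (a u) = free_cover (C n) u.
Proof. exact: (projective_freeM (g := p n) (f := free_cover (C n))). Qed.

Let ofP_ex n : exists b : {linear P n -> freeM R (C n)},
  forall x, free_cover (C n) (b x) = p n x.
Proof. by apply: Pproj => x; apply: free_cover_surj. Qed.

Let aP n := projT1 (cid (toP_ex n)).
Let bP n := projT1 (cid (ofP_ex n)).
Let aPE n u : p n (aP n u) = free_cover (C n) u.
Proof. by rewrite /aP; case: (cid (toP_ex n)). Qed.
Let bPE n x : free_cover (C n) (bP n x) = p n x.
Proof. by rewrite /bP; case: (cid (ofP_ex n)). Qed.

Let a_subproof n u : free_cover (C n) u = 0 -> p n (aP n u) = 0.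
Proof. by rewrite aPE. Qed.
Let b_subproof n x : p n x = 0 -> free_cover (C n) (bP n x) = 0.
Proof. by rewrite bPE. Qed.

Let a n : {linear syz (C n) -> K n} := ker_map (@a_subproof n).
Let b n : {linear K n -> syz (C n)} := ker_map (@b_subproof n).

Let id_ (M : lmodType R) : {linear M -> M} := idfun.

Let cover_exact (M : lmodType R) (x : freeM R M) :
  free_cover M x = 0 -> exists k, syz_inc M k = x.
Proof. by move=> /eqP x0; exists (@KerM R _ _ (free_cover M) x x0). Qed.

Let syz_inj (M : lmodType R) : injective (syz_inc M).
Proof. exact: val_inj. Qed.

(** Both [g] and [h] are arbitrary, to cover the two halves of the total differential: the one of C
    with [h] the identity, and the one of D with [g] the identity. *)
Let b_natural m n (g : {linear C m -> C n}) (k : {linear K m -> K n})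
    (q : {linear P m -> P n}) (M M' : lmodType R) (h : {linear M -> M'}) t :
  (forall x, i n (k x) = q (i m x)) -> (forall x, p n (q x) = g (p m x)) ->
  tens_map (i m) (id_ M) t = 0 ->
  tens_map (syz_map g) h (tens_map (b m) (id_ M) t) =
  tens_map (b n) (id_ M') (tens_map k h t).
Proof.
move=> kq qg t0; rewrite !tens_map_comp.
transitivity (tens_map (syz_map g \o b m) h t); first exact: tens_map_ext.
transitivity (tens_map (b n \o k) h t); last exact: tens_map_ext.
have := @tor_lift_unique R (K m) (P m) (syz (C n)) (freeM R (C n)) (C n) M M'
  (i m) (syz_inc (C n)) (free_cover (C n)) (syz_map g \o b m) (b n \o k)
  (free_map g \o bP m) (bP n \o q) h (@Pproj m) (@syz_inj (C n))
  (@cover_exact (C n)).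
apply=> //.
  by move=> x; rewrite /= -kq.
by move=> x; rewrite /= bPE qg -bPE; apply: free_cover_map.
Qed.

Let a_natural m n (g : {linear C m -> C n}) (k : {linear K m -> K n})
    (q : {linear P m -> P n}) (M M' : lmodType R) (h : {linear M -> M'}) t :
  (forall x, i n (k x) = q (i m x)) -> (forall x, p n (q x) = g (p m x)) ->
  tens_map (syz_inc (C m)) (id_ M) t = 0 ->
  tens_map k h (tens_map (a m) (id_ M) t) =
  tens_map (a n) (id_ M') (tens_map (syz_map g) h t).
Proof.
move=> kq qg t0; rewrite !tens_map_comp.
transitivity (tens_map (k \o a m) h t); first exact: tens_map_ext.
transitivity (tens_map (a n \o syz_map g) h t); last exact: tens_map_ext.
have := @tor_lift_unique R (syz (C m)) (freeM R (C m)) (K n) (P n) (C n) M M'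
  (syz_inc (C m)) (i n) (p n) (k \o a m) (a n \o syz_map g)
  (q \o aP m) (aP n \o free_map g) h (@projective_freeM R (C m))
  (@ker_inc_inj _ _ _ p n) (@ker_inc_exact _ _ _ p n).
apply=> //.
  by move=> x; apply: kq.
by move=> x; rewrite /= aPE qg aPE; apply/esym/free_cover_map.
Qed.

Let abK n (M : lmodType R) (t : tensor (K n) M) :
  tens_map (i n) (id_ M) t = 0 ->
  tens_map (a n) (id_ M) (tens_map (b n) (id_ M) t) = t.
Proof.
move=> t0; rewrite tens_map_comp -[RHS]tens_map_id.
transitivity (tens_map (a n \o b n) (id_ M) t); first exact: tens_map_ext.
have := @tor_lift_unique R (K n) (P n) (K n) (P n) (C n) M M
  (i n) (i n) (p n) (a n \o b n) idfun (aP n \o bP n) idfun (id_ M) (@Pproj n)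
  (@ker_inc_inj _ _ _ p n) (@ker_inc_exact _ _ _ p n).
apply=> //.
by move=> x; rewrite /= aPE bPE.
Qed.

(** The maps [b] carry [k] to a cycle [tau] of the Tor complex. A chain [s] bounding [tau] is
    carried back by the maps [a], and [abK] identifies the boundary of the result with [k]. *)
Lemma tor_kernel_acyclic : acyclic (tor_complex C D) ->
  forall n (k : tensor_complex K D n),
    tensor_chain_map i (chain_id D) n k = 0 -> is_cycle k ->
  exists t, tensor_chain_map i (chain_id D) (n + 1) t = 0 /\
    cdiff (tensor_complex K D) (n + 1) n t = k.
Proof.
move=> /acyclic_elt Tac n k /tot_map_eq0 k0 kc.
have bk_ker i' j' (t : tensor (K i') (D j')) : tens_map (i i') (id_ (D j')) t = 0 ->
    tens_map (b i') (id_ (D j')) t \in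
    ker_pred (tens_map (syz_inc (C i')) (id_ (D j'))).
  move=> t0; apply/eqP; rewrite tens_map_comp.
  transitivity (tens_map (bP i' \o i i') (id_ (D j') \o id_ (D j')) t).
    exact: tens_map_ext.
  by rewrite -tens_map_comp t0 linear0.
have kq0 (q : tot_idx n) :
    tens_map (i (val q).1) (id_ (D (val q).2)) ((k : dsum _) q) = 0.
  by rewrite -(tot_comp_idx (F := tensor_bifunctor R)); apply: k0.
pose taufun (q : tot_idx n) : tot_term (tor_bifunctor R) C D q :=
  KerM (bk_ker _ _ _ (kq0 q)).
have taufin : finite_set [set q | taufun q <> 0].
  apply: sub_finite_set (dsum_finite k) => q /= tq kq; apply: tq.
  apply: val_inj.
  by rewrite -[LHS]/(tens_map (b _) (id_ _) ((k : dsum _) q)) kq linear0.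
pose tau : tor_complex C D n :=
  @DSum R _ (@tot_term R (tor_bifunctor R) C D n) taufun taufin.
have tauE i' j' : val (tot_comp (F := tor_bifunctor R) tau i' j') =
    tens_map (b i') (id_ (D j')) (tot_comp (F := tensor_bifunctor R) k i' j').
  by rewrite /tot_comp; case: {-}_ / idP => // _; rewrite [RHS]linear0.
have [m|s sE] := Tac n tau.
  have [nm|] := eqVneq n (m + 1); last exact: cdiff_shape.
  apply: tot_ext => i' j' ij; rewrite tot_comp0 tot_comp_diff //.
  apply: val_inj; rewrite -[LHS]/(tens_map (syz_map (cdiff C (i' + 1) i'))
    (id_ (D j')) (val (tot_comp (F := tor_bifunctor R) tau (i' + 1) j')) +
    (-1) ^ i' *: tens_map (syz_map (id_ (C i'))) (cdiff D (j' + 1) j')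
     (val (tot_comp (F := tor_bifunctor R) tau i' (j' + 1)))).
  rewrite !tauE.
  rewrite (b_natural (k := cdiff K (i' + 1) i') (q := cdiff P (i' + 1) i')) //;
    first last.
  - exact: k0.
  - by move=> x; rewrite cmap_diff.
  rewrite (b_natural (k := id_ (K i')) (q := id_ (P i'))) //; last exact: k0.
  rewrite -linearZ_LR -linearD.
  have := congr1 (fun z => tot_comp (F := tensor_bifunctor R) z i' j') (kc m).
  rewrite tot_comp_diff // tot_comp0 => e.
  exact: (etrans (congr1 (tens_map (b i') (id_ (D j'))) e) (linear0 _)).
pose tfun (q : tot_idx (n + 1)) : tot_term (tensor_bifunctor R) K D q :=
  tens_map (a (val q).1) (id_ (D (val q).2)) (val ((s : dsum _) q)).
have tfin : finite_set [set q | tfun q <> 0].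
  apply: sub_finite_set (dsum_finite s) => q /= tq sq; apply: tq.
  by rewrite /tfun sq; apply: linear0.
pose t : tensor_complex K D (n + 1) :=
  @DSum R _ (@tot_term R (tensor_bifunctor R) K D (n + 1)) tfun tfin.
have tE i' j' : tot_comp (F := tensor_bifunctor R) t i' j' =
    tens_map (a i') (id_ (D j')) (val (tot_comp (F := tor_bifunctor R) s i' j')).
  by rewrite /tot_comp; case: {-}_ / idP => // _; apply/esym/linear0.
exists t; split.
  apply/tot_map_eq0 => i' j'; rewrite tE.
  set u := tot_comp _ _ _; rewrite -[LHS]/(tens_map (i i') (id_ (D j'))
    (tens_map (a i') (id_ (D j')) (val u))) tens_map_comp.
  transitivity
    (tens_map (aP i' \o syz_inc (C i')) (id_ (D j') \o id_ (D j')) (val u)).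
    exact: tens_map_ext.
  by rewrite -tens_map_comp (kerM_valE u) linear0.
apply: tot_ext => i' j' ij; rewrite tot_comp_diff //.
rewrite -[LHS]/(tens_map (cdiff K (i' + 1) i') (id_ (D j'))
    (tot_comp (F := tensor_bifunctor R) t (i' + 1) j') +
  (-1) ^ i' *: tens_map (id_ (K i')) (cdiff D (j' + 1) j')
    (tot_comp (F := tensor_bifunctor R) t i' (j' + 1))) !tE.
rewrite (a_natural (n := i') (g := cdiff C (i' + 1) i') (q := cdiff P (i' + 1) i')) //;
  first last.
- exact: kerM_valE.
- by move=> x; rewrite cmap_diff.
rewrite (a_natural (n := i') (g := id_ (C i')) (q := id_ (P i'))) //; last first.
  exact: kerM_valE.
rewrite -linearZ_LR -linearD -[RHS]abK; last exact: k0.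
congr (tens_map _ _ _); rewrite -tauE -sE.
by rewrite (tot_comp_diff (F := tor_bifunctor R)).
Qed.
End TorComparison.

(** * Free approximations and tensor products *)

Section TensorReflects.
Variable R : idomainType.
Implicit Types A B C D E F G K P Q : complex R.

Lemma tensor_chain_map_comp A B C A' B' C' (f : chain_map A B) (g : chain_map B C)
    (h : chain_map A C) (f' : chain_map A' B') (g' : chain_map B' C')
    (h' : chain_map A' C') :
  (forall n x, g n (f n x) = h n x) -> (forall n x, g' n (f' n x) = h' n x) ->
  forall n x, tensor_chain_map g g' n (tensor_chain_map f f' n x) =
    tensor_chain_map h h' n x.
Proof.
move=> gf gf' n x.
apply: (tensor_complex_ext (g := tensor_chain_map g g' n \o tensor_chain_map f f' n)
  (h := tensor_chain_map h h' n)) => i j e y z.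
rewrite -[LHS]/(tensor_chain_map g g' n (tensor_chain_map f f' n (ctens e y z))).
by rewrite !tensor_chain_mapE gf gf'.
Qed.

Lemma tensor_chain_map_id A B n x :
  tensor_chain_map (chain_id A) (chain_id B) n x = x.
Proof.
apply: (tensor_complex_ext (g := tensor_chain_map (chain_id A) (chain_id B) n)
  (h := idfun)) => i j e y z.
by rewrite tensor_chain_mapE.
Qed.

Lemma is_cycle_map A B (f : chain_map A B) n (x : A n) : is_cycle x -> is_cycle (f n x).
Proof. by move=> xc k; rewrite -cmap_diff xc linear0. Qed.

Section Exactness.
Variables (P C Q D : complex R) (p : chain_map P C) (q : chain_map Q D).
Hypothesis psurj : forall n c, exists x, p n x = c.
Hypothesis qsurj : forall n c, exists x, q n x = c.

Lemma tensor_chain_map_surj n y : exists x, tensor_chain_map p q n x = y.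
Proof. by apply: tot_map_preimage => i j; apply: tens_map_surj. Qed.
End Exactness.

Lemma tensor_chain_map_exactl K P C D (i : chain_map K P) (p : chain_map P C) :
  (forall n c, exists x, p n x = c) ->
  (forall n x, p n x = 0 -> exists k, i n k = x) ->
  forall n x, tensor_chain_map p (chain_id D) n x = 0 ->
  exists k, tensor_chain_map i (chain_id D) n k = x.
Proof.
move=> psurj pex n x /tot_map_eq0 x0; apply: tot_map_preimage => a b.
exact: (tens_exactl (psurj a) (pex a) (x0 a b)).
Qed.

Lemma tensor_chain_map_exactr K P C D (i : chain_map K P) (p : chain_map P C) :
  (forall n c, exists x, p n x = c) ->
  (forall n x, p n x = 0 -> exists k, i n k = x) ->
  forall n x, tensor_chain_map (chain_id D) p n x = 0 ->
  exists k, tensor_chain_map (chain_id D) i n k = x.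
Proof.
move=> psurj pex n x /tot_map_eq0 x0; apply: tot_map_preimage => a b.
exact: (tens_exactr (psurj b) (pex b) (x0 a b)).
Qed.

Lemma tensor_chain_map0 A B C A' B' C' (f : chain_map A B) (g : chain_map B C)
    (f' : chain_map A' B') (g' : chain_map B' C') :
  (forall n x, g n (f n x) = 0) \/ (forall n x, g' n (f' n x) = 0) ->
  forall n x, tensor_chain_map g g' n (tensor_chain_map f f' n x) = 0.
Proof.
move=> gf n x.
apply: (tensor_complex_ext (g := tensor_chain_map g g' n \o tensor_chain_map f f' n)
  (h := \0)) => i j e y z.
rewrite -[LHS]/(tensor_chain_map g g' n (tensor_chain_map f f' n (ctens e y z))).
by rewrite !tensor_chain_mapE; case: gf => ->; rewrite (ctens0l, ctens0r).
Qed.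

Hypothesis pid : principal_ideal_domain R.

Lemma ker_cover_contraction F C (eta : chain_map F C) :
  (forall n, projective (F n)) -> quasi_isomorphism eta ->
  exists h, @contraction R (ker_complex (cover_map eta)) h.
Proof.
move=> Fproj qi.
apply: acyclic_projective_contraction => //; last exact: ker_cover_acyclic.
move=> n; have Pproj := @cover_complex_projective R F C Fproj n.
exact: projective_submodule Pproj (@ker_inc_inj _ _ _ (cover_map eta) n).
Qed.

Lemma tensor_reflects_boundariesl F C D (eta : chain_map F C) :
  (forall n, projective (F n)) -> quasi_isomorphism eta ->
  acyclic (tor_complex C D) ->
  reflects_boundaries (tensor_chain_map eta (chain_id D)).
Proof.
move=> Fproj qi tor0 n x xc xb.
have [h hK] := ker_cover_contraction Fproj qi.
apply: (@boundary_chase R _ _ _ _ (tensor_chain_map (cover_in F C) (chain_id D))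
  (tensor_chain_map (cover_out F C) (chain_id D))
  (tensor_chain_map (cover_map eta) (chain_id D))
  (tensor_chain_map (ker_inc (cover_map eta)) (chain_id D)) _ _ _ _ _ _ n x xc).
- move=> m y; rewrite -[RHS]tensor_chain_map_id.
  by apply: tensor_chain_map_comp.
- apply: tensor_chain_map_surj => [m c|m d]; first exact: cover_map_surj.
  by exists d.
- apply: tensor_chain_map_exactl; first exact: cover_map_surj.
  exact: ker_inc_exact.
- by apply: tensor_chain_map0; left => m y; apply: ker_inc0.
- exact: contraction_tensorl hK.
- apply: tor_kernel_acyclic => //; first exact: cover_complex_projective.
  exact: cover_map_surj.
- rewrite (tensor_chain_map_comp (h := eta) (h' := chain_id D)) //.
  exact: cover_map_in.
Qed.

Lemma tensor_reflects_boundariesr F D C (eta : chain_map F C) :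
  (forall n, projective (F n)) -> quasi_isomorphism eta ->
  (forall n, projective (D n)) ->
  reflects_boundaries (tensor_chain_map (chain_id D) eta).
Proof.
move=> Fproj qi Dproj n x xc xb.
have [h hK] := ker_cover_contraction Fproj qi.
apply: (@boundary_chase R _ _ _ _ (tensor_chain_map (chain_id D) (cover_in F C))
  (tensor_chain_map (chain_id D) (cover_out F C))
  (tensor_chain_map (chain_id D) (cover_map eta))
  (tensor_chain_map (chain_id D) (ker_inc (cover_map eta))) _ _ _ _ _ _ n x xc).
- move=> m y; rewrite -[RHS]tensor_chain_map_id.
  by apply: tensor_chain_map_comp.
- apply: tensor_chain_map_surj => [m d|m c]; last exact: cover_map_surj.
  by exists d.
- apply: tensor_chain_map_exactr; first exact: cover_map_surj.
  exact: ker_inc_exact.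
- by apply: tensor_chain_map0; right => m y; apply: ker_inc0.
- exact: contraction_tensorr hK.
(* Each [D i] is flat, so an element killed by the inclusion is already 0. *)
- move=> m k /tot_map_eq0 k0 _; exists 0; split; first exact: linear0.
  rewrite linear0; apply: tot_ext => i j _; rewrite tot_comp0; apply/esym.
  apply: (projective_flat (i := ker_inc (cover_map eta) j)); last exact: k0.
    exact: Dproj.
  by move=> l l0; apply: (@ker_inc_inj _ _ _ (cover_map eta) j); rewrite l0 linear0.
- rewrite (tensor_chain_map_comp (h := chain_id D) (h' := eta)) //.
  exact: cover_map_in.
Qed.

(** The map is factored through F (x) D: while [G] is replaced by [D], the other factor is the
    projective [F], and only the passage from F (x) D to C (x) D meets Tor. *)
Lemma tensor_approximation_reflects F C G D (eta : chain_map F C)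
    (zeta : chain_map G D) :
  free_approximation eta -> free_approximation zeta ->
  acyclic (tor_complex C D) ->
  reflects_boundaries (tensor_chain_map eta zeta).
Proof.
move=> [Ffree Fqi] [Gfree Gqi] tor0 n x xc xb.
have Fproj m := is_free_projective (Ffree m).
have Gproj m := is_free_projective (Gfree m).
apply: (tensor_reflects_boundariesr Gproj Gqi Fproj xc).
apply: (tensor_reflects_boundariesl Fproj Fqi tor0); first exact: is_cycle_map.
by rewrite (tensor_chain_map_comp (h := eta) (h' := zeta)).
Qed.
End TensorReflects.

(** * Connecting maps and brackets *)

Section BoundaryMap.
Variable R : idomainType.
Implicit Types F G H D : complex R.

(** The value does not depend on the triple picked by [xget]: if z' - z = dw and w' lifts w, then y'
    - y - dw' = s v, and v bounds the difference of the two cycles of [F]. *)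
Lemma connectingE F G H (s : chain_map F G) (t : chain_map G H) m n
    (z : cycles H m) (y : G m) (x : cycles F n) :
  short_exact s t -> m = n + 1 -> t m y = val z ->
  s n (val x) = cdiff G m n y -> connecting s t n (hclass H m z) = hclass F n x.
Proof.
move=> ex mn tyz sxy; subst m; rewrite /connecting; set S := [set k | _].
have [z' [y' [x' [zz ty' sx' <-]]]] : S (xget 0 S).
  by apply: xgetPex; exists (hclass F n x), z, y, x.
have /hclass_eq [w wE] := zz.
have [_ _ /(_ w) [w' w'E]] := ex (n + 1 + 1).
have [_ /(_ (y' - y - cdiff G _ _ w')) [+ _] _] := ex (n + 1).
case.
  by rewrite !linearB cmap_diff w'E wE tyz ty' subrr.
move=> v vE; apply/hclass_eq; exists v.
have [sinj _ _] := ex n; apply: sinj.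
by rewrite cmap_diff vE !linearB cdiff_diff sxy sx' subr0.
Qed.

Lemma inverse_injective (S T : lmodType R) (f : S -> T) x :
  injective f -> inverse f (f x) = x.
Proof.
move=> finj; apply: finj; rewrite /inverse.
by apply: (@xgetPex _ 0 [set x' | f x' = f x]); exists x.
Qed.

Lemma reflects_boundaries_injective F G (f : chain_map F G) n :
  reflects_boundaries f -> injective (homology_map f n).
Proof.
move=> fb p q; have [x <-] := hclass_surj p; have [y <-] := hclass_surj q.
rewrite !homology_mapE => /hclass_eq [w wE]; apply/hclass_eq.
apply: fb; first by move=> k; rewrite linearB !cycleE subrr.
by exists w; rewrite linearB.
Qed.

(** Injectivity survives because the sequence splits in each degree: 1 - sigma t takes values in the
    image of [s], and its lift through [s] is a retraction, which tensoring preserves. *)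
Lemma short_exact_tensor F G H (s : chain_map F G) (t : chain_map G H) D :
  (forall n, projective (G n)) -> (forall n, projective (H n)) ->
  short_exact s t ->
  short_exact (tensor_chain_map s (chain_id D)) (tensor_chain_map t (chain_id D)).
Proof.
move=> Gproj Hproj ex.
have sinj n : injective (s n) by have [] := ex n.
have tsurj n z : exists y, t n y = z by have [_ _] := ex n; apply.
have tex n y : t n y = 0 -> exists x, s n x = y by have [_ /(_ y) [h _] _] := ex n.
have ts n x : t n (s n x) = 0.
  by have [_ /(_ (s n x)) [_ h] _] := ex n; apply: h; exists x.
have ret n : exists rho : {linear G n -> F n}, forall x, rho (s n x) = x.
  have [sigma sigmaE] := Hproj n _ _ (t n) idfun (tsurj n).
  have [y|rho rhoE] := Gproj n _ _ (s n) (idfun \- (sigma \o t n)).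
    by apply: tex; rewrite /= linearB sigmaE subrr.
  by exists rho => x; apply: sinj; rewrite rhoE /= ts linear0 subr0.
move=> n; split.
- move=> x x' /eqP; rewrite -subr_eq0 -linearB => /eqP/tot_map_eq0 xx.
  apply/eqP; rewrite -subr_eq0; apply/eqP; apply: tot_ext => i j _.
  rewrite tot_comp0; have [rho rhoE] := ret i.
  set u := tot_comp _ _ _.
  have -> : u = tens_map rho idfun (tens_map (s i) (idfun : {linear D j -> D j}) u).
    rewrite tens_map_comp -[LHS]tens_map_id.
    by apply: tens_map_ext => // y /=; rewrite rhoE.
  exact: (etrans (congr1 (tens_map rho idfun) (xx i j)) (linear0 _)).
- move=> y; split; first exact: tensor_chain_map_exactl.
  by move=> [x <-]; apply: tensor_chain_map0; left.
- by apply: tensor_chain_map_surj => // m d; exists d.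
Qed.
End BoundaryMap.

Section Cross.
Variables (R : idomainType) (P Q : complex R).

Lemma crossDl i j n (e : i + j = n) (p p' : homology P i) (q : homology Q j) :
  cross e (p + p') q = cross e p q + cross e p' q.
Proof.
have [x <-] := hclass_surj p; have [x' <-] := hclass_surj p'.
have [y <-] := hclass_surj q; rewrite -linearD !crossE -linearD.
congr (hclass _ _ _); apply: val_inj.
by have := ctens_linearl e (val y) 1 (val x) (val x'); rewrite !scale1r.
Qed.

Lemma crossDr i j n (e : i + j = n) (p : homology P i) (q q' : homology Q j) :
  cross e p (q + q') = cross e p q + cross e p q'.
Proof.
have [x <-] := hclass_surj p; have [y <-] := hclass_surj q.
have [y' <-] := hclass_surj q'; rewrite -linearD !crossE -linearD.
congr (hclass _ _ _); apply: val_inj.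
by have := ctens_linearr e (val x) 1 (val y) (val y'); rewrite !scale1r.
Qed.

Lemma crossNl i j n (e : i + j = n) (p : homology P i) (q : homology Q j) :
  cross e (- p) q = - cross e p q.
Proof.
apply/eqP; rewrite -addr_eq0 -crossDl addNr; apply/eqP.
by apply: (addrI (cross e 0 q)); rewrite -crossDl !addr0.
Qed.

Lemma crossNr i j n (e : i + j = n) (p : homology P i) (q : homology Q j) :
  cross e p (- q) = - cross e p q.
Proof.
apply/eqP; rewrite -addr_eq0 -crossDr addNr; apply/eqP.
by apply: (addrI (cross e p 0)); rewrite -crossDr !addr0.
Qed.
End Cross.

Section Bracket.
Variables (R : idomainType) (P Q : complex R) (k k' l l' n : int).
Hypotheses (hk : k' = k + 1) (hl : l' = l + 1).
Hypotheses (e1 : k + l' = n) (e2 : k' + l = n).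

(* The representative of the coset <<[x], r, [y]>> built from arbitrary chains
   with du = r x and dv = r y. *)
Definition bracket (x : P k) (u : P k') (y : Q l) (v : Q l') : tensor_complex P Q n :=
  (-1) ^ (k + 1) *: ctens e1 x v + ctens e2 u y.

Let sgn : (-1) ^ (k + 1) * (-1) ^ (k + 1) = 1 :> R.
Proof. by rewrite -exprzMl ?unitrN1 // mulrNN mulr1 exp1rz. Qed.

(** The two summands contribute r x (x) y with coefficients (-1)^(k+1) (-1)^k = -1 and 1; this is
    the origin of the sign in [bracket]. *)
Lemma bracket_is_cycle r x u y v :
  is_cycle x -> is_cycle y ->
  cdiff P k' k u = r *: x -> cdiff Q l' l v = r *: y ->
  is_cycle (bracket x u y v).
Proof.
move=> xc yc ux vy m; have [nm|] := eqVneq n (m + 1); last exact: cdiff_shape.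
have f1 : k + l = m by apply: (addIr 1); rewrite -nm -e1 hl addrA.
have f2 : k - 1 + l' = m by apply: (addIr 1); rewrite -nm -e1 addrAC subrK.
have f3 : k' + (l - 1) = m by apply: (addIr 1); rewrite -nm -e2 -addrA subrK.
rewrite linearD linearZ_LR (cdiff_ctens e1 f2 f1) // (cdiff_ctens e2 f1 f3) //.
rewrite xc yc ctens0l ctens0r scaler0 addr0 add0r ux vy ctensZl ctensZr !scalerA.
rewrite exprzDr ?unitrN1 // expr1z mulrN1 mulNr -exprzMl ?unitrN1 // mulrNN.
by rewrite mulr1 exp1rz mulN1r scaleNr addNr.
Qed.

Let is_boundaryE (A : complex R) m m' (x : A m) : m' = m + 1 ->
  @is_boundary R A m x -> exists z : A m', cdiff A m' m z = x.
Proof. by move=> ->. Qed.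

Let is_cycleE (A : complex R) m m' (x : A m) : m = m' + 1 ->
  cdiff A m m' x = 0 -> @is_cycle R A m x.
Proof. by move=> mm; subst m => h; apply: is_cycleP; rewrite addrK. Qed.

Let cancellation (M : zmodType) (a b c d u v x w z : M) :
  a - b + c + (d + (u - v)) - (x - (b - w - d)) =
  a + z - (w + v) - (x + (z - u - c)).
Proof.
rewrite !opprD !opprK !addrA.
rewrite [LHS](ACl (1*3*5*6*7*9*(4*10)*(2*8)))/=.
rewrite [RHS](ACl (1*8*7*4*5*3*(2*6)))/=.
by rewrite !addrN addNr !addr0.
Qed.

Lemma bracket_unique r x u y v x0 u0 y0 v0 :
  is_cycle x -> is_cycle y -> is_cycle x0 -> is_cycle y0 ->
  is_boundary (x - x0) -> is_boundary (y - y0) ->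
  cdiff P k' k u = r *: x -> cdiff Q l' l v = r *: y ->
  cdiff P k' k u0 = r *: x0 -> cdiff Q l' l v0 = r *: y0 ->
  exists c w, [/\ is_cycle c, is_cycle w & is_boundary
    (bracket x u y v - bracket x0 u0 y0 v0 - (ctens e1 x c + ctens e2 w y))].
Proof.
move=> xc yc x0c y0c /(is_boundaryE hk) [s sE] /(is_boundaryE hl) [t tE].
move=> ux vy ux0 vy0.
(* Both u - u0 and r s have differential r (x - x0), so [w] is a cycle; likewise [c], which absorbs
   the sign of the bracket. *)
pose w := u - u0 - r *: s; pose c := (-1) ^ (k + 1) *: (v - v0 - r *: t).
have wE : cdiff P k' k w = 0.
  by rewrite !linearB linearZ_LR ux ux0 sE -!scalerBr subrr scaler0.
have cE : cdiff Q l' l c = 0.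
  have v0E : cdiff Q l' l (v - v0 - r *: t) = 0.
    by rewrite !linearB linearZ_LR vy vy0 tE -!scalerBr subrr scaler0.
  by rewrite linearZ_LR v0E scaler0.
exists c, w; split; [exact: is_cycleE cE|exact: is_cycleE wE|].
have g : k' + l' = n + 1 by rewrite hl addrA e2.
(* The signed sum accounts for the difference of the brackets up to x0 (x) c + w (x) y; subtracting
   s (x) c replaces x0 by x. *)
exists ((-1) ^ (k + 1) *: (ctens g s v + ctens g u0 t) - ctens g s c).
rewrite linearB linearZ_LR linearD !(cdiff_ctens g e1 e2) // cE sE tE ux0 vy.
rewrite ctens0r scaler0 addr0 /bracket -hk.
have sgn' : (-1) ^ k' * (-1) ^ k' = 1 :> R by rewrite hk.
rewrite !scalerDr !scalerA sgn' !scale1r !ctensBl !ctensBr !ctensZl !ctensZr.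
rewrite -hk; set X := (-1) ^ k' *: ctens e1 x (v - v0 - r *: t).
rewrite !ctensBr ctensZr !scalerBr.
exact: (@cancellation (tensor_complex P Q n) ((-1) ^ k' *: ctens e1 x v)
  ((-1) ^ k' *: ctens e1 x0 v) (r *: ctens e2 s y) ((-1) ^ k' *: (r *: ctens e1 x0 t))
  (ctens e2 u0 y) (ctens e2 u0 y0) X ((-1) ^ k' *: ctens e1 x0 v0) (ctens e2 u y)).
Qed.
End Bracket.

(** * The cosets and the boundary map *)

Section TorCoset.
Variables (R : idomainType) (P Q : complex R).
Variables (gP : weak_splitting P) (gQ : weak_splitting Q).

Lemma bracket_class_unique k k' l l' n (hk : k' = k + 1) (hl : l' = l + 1)
    (e1 : k + l' = n) (e2 : k' + l = n) r (x x0 : cycles P k) (y y0 : cycles Q l)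
    (u u0 : P k') (v v0 : Q l') (z z0 : cycles (tensor_complex P Q) n) :
  hclass P k x = hclass P k x0 -> hclass Q l y = hclass Q l y0 ->
  cdiff P k' k u = r *: val x -> cdiff Q l' l v = r *: val y ->
  cdiff P k' k u0 = r *: val x0 -> cdiff Q l' l v0 = r *: val y0 ->
  val z = bracket e1 e2 (val x) u (val y) v ->
  val z0 = bracket e1 e2 (val x0) u0 (val y0) v0 ->
  exists c w, hclass _ n z =
    hclass _ n z0 + (cross e1 (hclass P k x) c + cross e2 w (hclass Q l y)).
Proof.
move=> /hclass_eq xx /hclass_eq yy ux vy ux0 vy0 zE z0E.
have [c [w [cc wc [t tE]]]] := bracket_unique hk hl e1 e2 (fun k => cycleE x k)
  (fun k => cycleE y k) (fun k => cycleE x0 k) (fun k => cycleE y0 k) xx yy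
  ux vy ux0 vy0.
exists (hclass Q l' (Cycle (cc (l' - 1)))), (hclass P k' (Cycle (wc (k' - 1)))).
rewrite !crossE -[X in _ + X](linearD (hclass _ n)) -(linearD (hclass _ n)).
apply/hclass_eq; exists t.
by rewrite tE -zE -z0E -addrA -opprD.
Qed.

(** A weak splitting merely supplies one admissible choice of x, u, y, v, so the coset can be read
    off any other, for instance one coming from free approximations, whatever the splittings. The
    degrees [k'] and [l'] are variables because the chain over A in the theorem has degree i rather
    than i - 1 + 1. *)
Lemma tor_coset_bracketP k k' l l' n (e : k + l + 1 = n) (hk : k' = k + 1)
    (hl : l' = l + 1) (e1 : k + l' = n) (e2 : k' + l = n) r
    (x : cycles P k) (y : cycles Q l) (u : P k') (v : Q l')
    (z : cycles (tensor_complex P Q) n) :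
  cdiff P k' k u = r *: val x -> cdiff Q l' l v = r *: val y ->
  val z = bracket e1 e2 (val x) u (val y) v ->
  forall h, tor_coset gP gQ e (hclass P k x) r (hclass Q l y) h <->
  exists c w, h = hclass _ n z + (cross e1 (hclass P k x) c + cross e2 w (hclass Q l y)).
Proof.
move=> ux vy zE h; subst k' l'.
have E1 : degl_subproof e = e1 by apply: Prop_irrelevance.
have E2 : degr_subproof e = e2 by apply: Prop_irrelevance.
have chain (x' : ws_Z gP k) (y' : ws_Z gQ l) bp bq
    (z0 : cycles (tensor_complex P Q) n) :
    ws_pi gP k x' = hclass P k x -> ws_pi gQ l y' = hclass Q l y ->
    val bp = r *: x' -> val bq = r *: y' -> val z0 = tor_chain e x' y' bp bq ->
    exists c w, hclass _ n z0 =
      hclass _ n z + (cross e1 (hclass P k x) c + cross e2 w (hclass Q l y)).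
  move=> px qy pE qE z0E; rewrite -px -qy -!ws_gamma_class.
  apply: (bracket_class_unique (r := r) (u := ws_theta gP k bp)
    (v := ws_theta gQ l bq) erefl erefl _ _ _ _ ux vy _ zE).
  - by rewrite ws_gamma_class.
  - by rewrite ws_gamma_class.
  - by rewrite ws_theta_diff pE linearZ_LR.
  - by rewrite ws_theta_diff qE linearZ_LR.
  - by rewrite z0E /tor_chain E1 E2.
split.
  move=> [x' [y' [bp [bq [z0 [c0 [w0 [[px qy] [pE qE] z0E ->]]]]]]]].
  have [c [w ->]] := chain _ _ _ _ _ px qy pE qE z0E.
  exists (c + c0), (w + w0); rewrite E1 E2 crossDr crossDl -addrA.
  by congr (_ + _); rewrite addrACA.
move=> [c0 [w0 ->]].
have [x' px] := ws_pi_surj gP (hclass P k x).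
have [y' qy] := ws_pi_surj gQ (hclass Q l y).
have bpK : r *: x' \in ker_pred (ws_pi gP k).
  apply/eqP; rewrite linearZ_LR px -linearZ_LR -(linear0 (hclass P k)).
  by apply/hclass_eq; exists u; rewrite ux subr0.
have bqK : r *: y' \in ker_pred (ws_pi gQ l).
  apply/eqP; rewrite linearZ_LR qy -linearZ_LR -(linear0 (hclass Q l)).
  by apply/hclass_eq; exists v; rewrite vy subr0.
pose z0 : cycles (tensor_complex P Q) n :=
  Cycle (@tor_chain_diff R P Q gP gQ k l n e r x' y' (KerM bpK) (KerM bqK)
    (n - 1) erefl erefl).
have [c [w zz]] := chain _ _ (KerM bpK) (KerM bqK) z0 px qy erefl erefl erefl.
exists x', y', (KerM bpK), (KerM bqK), z0, (c0 - c), (w0 - w); split=> //.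
rewrite E1 E2 zz crossDr crossDl crossNr crossNl -addrA; congr (_ + _).
by rewrite [RHS]addrACA; congr (_ + _); rewrite addrC subrK.
Qed.
End TorCoset.

(** * Transfer along free approximations and the main computation *)

Lemma quasi_isomorphism_class (R : idomainType) (F C : complex R)
    (eta : chain_map F C) n (h : homology C n) : quasi_isomorphism eta ->
  exists x : cycles F n, homology_map eta n (hclass F n x) = h.
Proof.
move=> qi; have [g _ etag] := qi n.
by have [x xE] := hclass_surj (g h); exists x; rewrite xE etag.
Qed.

Lemma annihilated_lift (R : idomainType) (F C : complex R)
    (eta : chain_map F C) n n' r (x : cycles F n) : quasi_isomorphism eta ->
  n' = n + 1 -> r *: homology_map eta n (hclass F n x) = 0 ->
  exists u : F n', cdiff F n' n u = r *: val x.
Proof.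
move=> qi nn; subst n'; rewrite -!linearZ_LR -(linear0 (homology_map eta n)).
move=> /(bij_inj (qi n)); rewrite -(linear0 (hclass F n)) => /hclass_eq [u uE].
by exists u; rewrite uE subr0.
Qed.

Lemma tensor_chain_map_bracket (R : idomainType) (P P' Q Q' : complex R)
    (f : chain_map P P') (g : chain_map Q Q') k k' l l' n (e1 : k + l' = n)
    (e2 : k' + l = n) x u y v :
  tensor_chain_map f g n (bracket e1 e2 x u y v) =
  bracket e1 e2 (f k x) (f k' u) (g l y) (g l' v).
Proof. by rewrite linearD linearZ_LR !tensor_chain_mapE. Qed.

Lemma homology_map_cross (R : idomainType) (P P' Q Q' : complex R)
    (f : chain_map P P') (g : chain_map Q Q') i j n (e : i + j = n) p q :
  homology_map (tensor_chain_map f g) n (cross e p q) =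
  cross e (homology_map f i p) (homology_map g j q).
Proof.
have [x <-] := hclass_surj p; have [y <-] := hclass_surj q.
rewrite crossE !homology_mapE crossE; congr (hclass _ _ _); apply: val_inj.
exact: tensor_chain_mapE.
Qed.

Theorem theorem8p5 (R : idomainType) (R_pid : principal_ideal_domain R)
    (A B C D : complex R)
    (AD_acyclic : acyclic (tor_complex A D))
    (BD_acyclic : acyclic (tor_complex B D))
    (CD_acyclic : acyclic (tor_complex C D))
    (e : chain_map A B) (f : chain_map B C)
    (W : approx_diagram A B C) (W_exact : weak_exact_diagram e f W)
    (FD : complex R) (etaD : chain_map FD D)
    (etaD_approx : free_approximation etaD)
    (gA : weak_splitting A) (gC : weak_splitting C) (gD gD' : weak_splitting D)
    (i j : int) (a : homology C i) (b : homology D j) (r : R)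
    (ar0 : r *: a = 0) (rb0 : r *: b = 0) :
  [set boundary_map (tensor_diagram W etaD) (i + j) h
     | h in tor_coset gC gD (erefl (i + j + 1)) a r b] `<=`
  [set - k
     | k in tor_coset gA gD' (boundary_degree i j)
              (boundary_map W (i - 1) a) r b].
Proof.
have [[_ [FB_free _] etaC_approx] ses _ _] := W_exact.
have [FC_free etaC_qi] := etaC_approx; have [_ etaD_qi] := etaD_approx.
have ses_tens := short_exact_tensor FD
  (fun n => is_free_projective (FB_free n)) (fun n => is_free_projective (FC_free n)) ses.
have lift n (z : appC W n) : exists y, app_f W n y = z by have [_ _] := ses n; apply.
have pull n (y : appB W n) : app_f W n y = 0 -> exists x, app_e W n x = y.
  by have [_ /(_ y) [h _] _] := ses n.
have e_inj n : injective (app_e W n) by have [] := ses n.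
move=> _ [h hco <-].
have [x xa] := quasi_isomorphism_class a etaC_qi.
have [y yb] := quasi_isomorphism_class b etaD_qi.
subst a b.
have [u uE] := annihilated_lift (n' := i + 1) etaC_qi erefl ar0.
have [v vE] := annihilated_lift (n' := j + 1) etaD_qi erefl rb0.
have [x1 x1E] := lift _ (val x).
have [u1 u1E] := lift _ u.
have [x2 x2E] : exists x2, app_e W (i - 1) x2 = cdiff (appB W) i (i - 1) x1.
  by apply: pull; rewrite cmap_diff x1E cycleE.
have x2c : cdiff (appA W) (i - 1) (i - 1 - 1) x2 = 0.
  by apply: e_inj; rewrite cmap_diff x2E cdiff_diff linear0.
pose x2' : cycles (appA W) (i - 1) := Cycle x2c.
(* The order of the difference makes the differential of [u2] equal to r times [x2], with no
   sign. *)
have [u2 u2E] : exists u2, app_e W i u2 = r *: x1 - cdiff (appB W) (i + 1) i u1.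
  by apply: pull; rewrite linearB linearZ_LR cmap_diff x1E u1E uE subrr.
have u2d : cdiff (appA W) i (i - 1) u2 = r *: val x2'.
  apply: e_inj; rewrite cmap_diff u2E linearB linearZ_LR cdiff_diff subr0.
  by rewrite linearZ_LR x2E.
have ii : i = i - 1 + 1 by rewrite subrK.
have dA1 : i - 1 + (j + 1) = i + j by rewrite addrACA addNr addr0.
have bdA : boundary_map W (i - 1) (homology_map (etaC W) i (hclass (appC W) i x)) =
    homology_map (etaA W) (i - 1) (hclass (appA W) (i - 1) x2').
  rewrite /boundary_map inverse_injective; last exact: bij_inj (etaC_qi i).
  by rewrite (connectingE (x := x2') ses ii x1E x2E).
have degC1 : i + (j + 1) = i + j + 1 by rewrite addrA.
have degC2 : i + 1 + j = i + j + 1 by rewrite addrAC.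
pose z := Cycle (bracket_is_cycle erefl degC1 degC2 (cycleE x) (cycleE y)
  uE vE (i + j + 1 - 1)).
have zE : val (cycles_map (tensor_chain_map (etaC W) etaD) _ z) =
    bracket degC1 degC2 (val (cycles_map (etaC W) i x)) (etaC W (i + 1) u)
      (val (cycles_map etaD j y)) (etaD (j + 1) v).
  exact: tensor_chain_map_bracket.
have uE' : cdiff C (i + 1) i (etaC W (i + 1) u) = r *: val (cycles_map (etaC W) i x).
  by rewrite -cmap_diff uE linearZ_LR.
have vE' : cdiff D (j + 1) j (etaD (j + 1) v) = r *: val (cycles_map etaD j y).
  by rewrite -cmap_diff vE linearZ_LR.
(* The classes that form the indeterminacy also lift to the free approximations, so [h] is an image
   and can be inverted by injectivity. *)
have [c [w hE]] : exists (c : cycles FD (j + 1)) (w : cycles (appC W) (i + 1)),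
    h = homology_map (tensor_chain_map (etaC W) etaD) (i + j + 1)
      (hclass _ _ (z + (cross_cycle degC1 x c + cross_cycle degC2 w y))).
  move: hco; rewrite !homology_mapE.
  move=> /(tor_coset_bracketP gC gD (erefl (i + j + 1)) erefl erefl uE' vE' zE).
  move=> [c' [w' ->]].
  have [c <-] := quasi_isomorphism_class c' etaD_qi.
  have [w <-] := quasi_isomorphism_class w' etaC_qi.
  exists c, w; rewrite !linearD -!crossE !homology_map_cross !homology_mapE.
  by [].
have eta_inj : injective (homology_map (tensor_chain_map (etaC W) etaD) (i + j + 1)).
  apply: reflects_boundaries_injective.
  exact: (tensor_approximation_reflects R_pid etaC_approx etaD_approx CD_acyclic).
have [w1 w1E] := lift _ (val w).
have [w2 w2E] : exists w2, app_e W i w2 = cdiff (appB W) (i + 1) i w1.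
  by apply: pull; rewrite cmap_diff w1E cycleE.
have w2c : cdiff (appA W) i (i - 1) w2 = 0.
  by apply: e_inj; rewrite cmap_diff w2E cdiff_diff linear0.
pose w2' : cycles (appA W) i := Cycle w2c.
pose zA := Cycle (bracket_is_cycle erefl dA1 (erefl (i + j)) (cycleE x2') (cycleE y)
  u2d vE (i + j - 1)).
pose y1 : tensor_complex (appB W) FD (i + j + 1) :=
  bracket degC1 degC2 x1 u1 (val y) v +
    (ctens degC1 x1 (val c) + ctens degC2 w1 (val y)).
(* The bracket changes sign for two matching reasons: the exponent in [bracket] drops from i + 1 to
   i, and d u1 = r x1 - e u2, whose r x1 cancels against the differential of [v]. The cross products
   keep their sign. *)
pose xA := - zA + (cross_cycle dA1 x2' c + cross_cycle (erefl (i + j)) w2' y).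
have y1E : tensor_chain_map (app_f W) (chain_id FD) (i + j + 1) y1 =
    val (z + (cross_cycle degC1 x c + cross_cycle degC2 w y)).
  rewrite [LHS]linearD [X in _ + X = _]linearD tensor_chain_map_bracket.
  by rewrite !tensor_chain_mapE x1E u1E w1E.
have xAE : tensor_chain_map (app_e W) (chain_id FD) (i + j) (val xA) =
    cdiff (tensor_complex (appB W) FD) (i + j + 1) (i + j) y1.
  have -> : val xA = - bracket dA1 (erefl (i + j)) x2 u2 (val y) v +
    (ctens dA1 x2 (val c) + ctens (erefl (i + j)) w2 (val y)) by [].
  rewrite [LHS]linearD [X in _ + X = _]linearD linearN tensor_chain_map_bracket.
  rewrite !tensor_chain_mapE x2E u2E w2E.
  rewrite [RHS]linearD [X in _ = _ + X]linearD; congr (_ + (_ + _)).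
  - have degB : i + 1 + (j - 1) = i + j by rewrite addrACA addrN addr0.
    rewrite /bracket [RHS]linearD [X in _ = X + _]linearZ_LR.
    rewrite (cdiff_ctens degC1 dA1 (erefl (i + j))) //.
    rewrite (cdiff_ctens degC2 (erefl (i + j)) degB) // vE cycleE ctens0r scaler0 addr0.
    rewrite subrK exprzDr ?unitrN1 // expr1z mulrN1 ctensZr ctensBl ctensZl.
    rewrite scaleNr scalerDr scalerA -exprzMl ?unitrN1 // mulrNN mulr1 exp1rz scale1r.
    by rewrite addrA opprB [RHS]addrC.
  - have degB : i + j = i + j := erefl.
    by rewrite (cdiff_ctens degC1 dA1 degB) // cycleE ctens0r scaler0 addr0.
  - have degB : i + 1 + (j - 1) = i + j by rewrite addrACA addrN addr0.
    rewrite (cdiff_ctens degC2 (erefl (i + j)) degB) //.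
    by rewrite cycleE ctens0r scaler0 addr0.
pose T := tensor_chain_map (etaA W) etaD.
exists (- homology_map T (i + j) (hclass _ _ xA)); last first.
  rewrite opprK hE /boundary_map.
  have -> := inverse_injective
    (f := homology_map (etaC (tensor_diagram W etaD)) _) _ eta_inj.
  congr (homology_map T (i + j) _); apply/esym.
  exact: (connectingE ses_tens erefl y1E xAE).
rewrite bdA !homology_mapE.
have uE2 : cdiff A i (i - 1) (etaA W i u2) = r *: val (cycles_map (etaA W) (i - 1) x2').
  by rewrite -cmap_diff u2d linearZ_LR.
apply/(tor_coset_bracketP gA gD' (boundary_degree i j) ii erefl uE2 vE'
  (z := cycles_map T (i + j) zA)).
  exact: tensor_chain_map_bracket.
(* Negating [xA] makes the bracket positive and moves the sign to the cross products, where it is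
   absorbed by the indeterminacy. *)
exists (- homology_map etaD (j + 1) (hclass _ _ c)),
  (- homology_map (etaA W) i (hclass _ _ w2')).
rewrite crossNl crossNr -opprD -!homology_mapE -!homology_map_cross !crossE.
have lin (M N : lmodType R) (g : {linear M -> N}) p q s :
    - g (- p + (q + s)) = g p - (g q + g s).
  by rewrite !(linearD g) (linearN g) [LHS]opprD opprK.
exact: (lin _ _ (homology_map T (i + j) \o hclass _ (i + j)) zA
  (cross_cycle dA1 x2' c) (cross_cycle (erefl (i + j)) w2' y)).
Qed.
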